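(* Let $\Gamma$ be a group acting by combinatorial automorphisms on a finite-dimensional $\mathrm{CAT}(0)$ cube complex $X$ with finite staircase length. Let $s=(h_1\supset\cdots\supset h_l)$ be an $\mathcal{H}$-segment in $X$, and let $f_s$ be the corresponding median quasimorphism of $\Gamma\curvearrowright X$. Then, for every $n\ge 1$ and every class $\zeta\in H^n_{\Gamma,b}(X;\mathbb{R})$ that is non-transverse to the orbit $\Gamma s$, the cup product $[\delta^1 f_s]\cup\zeta$ is trivial in $H^{n+2}_{\Gamma,b}(X;\mathbb{R})$. In particular, $[\delta^1 f_s]\cup\zeta=0$ holds if $\zeta=[\delta^1 f_r]$ for another $\mathcal{H}$-segment $r=(k_1\supset\cdots\supset k_p)$ in $X$ such that each of the four pairs of orbits $(\Gamma h_1,\Gamma k_1)$, $(\Gamma h_1,\Gamma k_p)$, $(\Gamma h_l,\Gamma k_1)$, $(\Gamma h_l,\Gamma k_p)$ is non-transverse.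
   Context: Equivariant bounded cohomology: for an action of a group $\Gamma$ on a set $S$, $C^n_{\Gamma,b}(S;\mathbb{R}):=\ell^\infty(S^{n+1},\mathbb{R})^\Gamma$ (bounded functions invariant under the diagonal action) with simplicial coboundary $\delta^n\kappa(x_0,\dots,x_{n+1})=\sum_j(-1)^j\kappa(x_0,\dots,\hat x_j,\dots,x_{n+1})$; $H^*_{\Gamma,b}(S;\mathbb{R})$ is its cohomology; the cup product is induced by $(f\cup g)(x_0,\dots,x_{p+q})=f(x_0,\dots,x_p)\,g(x_p,\dots,x_{p+q})$. For a cube complex $X$ with vertex set $V$, $C^*_{\Gamma,b}(X;\mathbb{R}):=C^*_{\Gamma,b}(V;\mathbb{R})$ and $H^*_{\Gamma,b}(X;\mathbb{R}):=H^*_{\Gamma,b}(V;\mathbb{R})$. Halfspaces: let $D$ be the combinatorial path metric on the vertex set $V$ in the $1$-skeleton of $X$. For an edge $e$ with endpoints $a,b$, $V$ is the disjoint union of $\{v: D(v,a)<D(v,b)\}$ and $\{v: D(v,b)<D(v,a)\}$; each of these two sets is called a halfspace, and $e$ is said to be dual to it. $\mathcal{H}$ is the set of all halfspaces, and $\overline h:=V\setminus h$. For $x,y\in V$, $[x,y]_{\mathcal{H}}$ is the (finite) set of halfspaces $h$ with $y\in h$ and $x\in\overline h$. Two halfspaces $h,k$ are transverse ($h\pitchfork k$) if $h\cap k,\ \overline h\cap k,\ h\cap\overline k,\ \overline h\cap\overline k$ are all non-empty. A pair of orbits $\Gamma h,\Gamma k$ is non-transverse if there are no $\gamma,\gamma'\in\Gamma$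 with $\gamma h\pitchfork\gamma' k$. Finiteness conditions: $X$ is finite-dimensional if the dimensions of its cubes are bounded. A length-$\sigma$ staircase is a pair $(a_1\supset\cdots\supset a_\sigma,\ b_1\supset\cdots\supset b_\sigma)$ of properly decreasing chains of halfspaces with $a_i\pitchfork b_j$ for all $1\le j<i\le\sigma$ and $a_i\supsetneq b_i$ for all $i$. The staircase length of $X$ is the maximal length of a staircase in $X$ (or $\infty$). Segments: halfspaces $h\supset k$ are tightly nested if they are distinct and there is no halfspace $h'\ne h,k$ with $h\supset h'\supset k$. An $\mathcal{H}$-segment of length $l\ge1$ is a sequence $s=(h_1\supset\cdots\supset h_l)$ of halfspaces with consecutive ones tightly nested. $\Gamma$ acts on $\mathcal{H}$-segments; elements of $\Gamma s$ are called translates of $s$. A segment is contained in $[x,y]_{\mathcal{H}}$ if all its halfspaces are. The median quasimorphism $f_s\colon V\times V\to\mathbb{R}$ has $f_s(x,y)$ equal to the number of translates of $s$ contained in $[x,y]_{\mathcal{H}}$ minus the number of translates of $s$ contained in $[y,x]_{\mathcal{H}}$. If $X$ is finite-dimensional with finite staircase length, then $\delta^1 f_s$ is bounded, so $[\delta^1f_s]\in H^2_{\Gamma,b}(X;\mathbb{R})$ is defined. Heads, tails, non-transversality: a head of $s=(h_1\supset\cdots\supset h_l)$ is a vertex $\alpha\in\overline{h_1}$ that is an endpoint of an edge dual to $h_1$; a tail of $s$ is a vertex $\omega\in h_l$ that is an endpoint of an edge dual to $h_l$. A cochain $\kappa\in C^n_{\Gamma,b}(X;\mathbb{R})$ and a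 segment $t$ are non-transverse if for all $x_1,\dots,x_n\in V$ the value $\kappa(\alpha,x_1,\dots,x_n)$ is the same for all heads $\alpha$ of $t$, and the value $\kappa(\omega,x_1,\dots,x_n)$ is the same for all tails $\omega$ of $t$. $\kappa$ is non-transverse to a set of segments if it is non-transverse to each of its elements. A class $\zeta$ is non-transverse to a set of segments if it has a representing cocycle that is. *)

(* Defs.v *)
From HB Require Import structures.
From mathcomp Require Import all_boot all_order all_algebra.
From mathcomp Require Import finmap mathcomp_extra boolp classical_sets functions.
From mathcomp Require Import cardinality reals.
From Stdlib Require Import Relation_Operators.

Set Implicit Arguments.
Unset Strict Implicit.
Unset Printing Implicit Defensive.

Import Order.TTheory GRing.Theory Num.Theory.

Local Open Scope classical_set_scope.
Local Open Scope ring_scope.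
Local Open Scope quotient_scope.

(** * Equivariant bounded cohomology *)

Record group_action (G : groupType) (S : Type) := GroupAction {
  gact :> G -> S -> S;
  gact1 : forall x, gact 1%g x = x;
  gactM : forall g h x, gact (g * h)%g x = gact g (gact h x) }.

(* An n-cochain is a function of n+1 variables x_0, ..., x_n. *)
Definition cochain (R : realType) (S : Type) (n : nat) : Type :=
  ('I_n.+1 -> S) -> R.

Definition coboundary (R : realType) (S : Type) (n : nat)
    (f : cochain R S n) : cochain R S n.+1 :=
  fun x => \sum_(j < n.+2) (-1) ^+ j * f (fun i => x (lift j i)).

(* The degree N is kept independent of p and q in order to avoid casts between
   the (propositionally equal) degrees of the Leibniz rule; [inord] is only
   meaningful, and [cup_at] only used, for N = p + q. *)
Definition cup_at (R : realType) (S : Type) (p q N : nat)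
    (f : cochain R S p) (g : cochain R S q) : cochain R S N :=
  fun x => f (fun i => x (inord i)) * g (fun i => x (inord (p + i)%N)).

Arguments cup_at {R S p q} N f g.

Definition cup (R : realType) (S : Type) (p q : nat)
    (f : cochain R S p) (g : cochain R S q) : cochain R S (p + q)%N :=
  cup_at (p + q)%N f g.

Section Cup.
Variables (R : realType) (S : Type).

Lemma coboundaryB n (f g : cochain R S n) :
  coboundary (f - g) = coboundary f - coboundary g.
Proof.
apply/funext => x; rewrite -[RHS]/(coboundary f x - coboundary g x).
rewrite /coboundary -sumrB.
by apply: eq_bigr => j _; rewrite -mulrBr.
Qed.

Lemma coboundary0 n : coboundary (0 : cochain R S n) = 0.
Proof.
by apply/funext => x; rewrite /coboundary big1 // => j _; rewrite mulr0.
Qed.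

Lemma coboundary_cup_at p q N (f : cochain R S p) (g : cochain R S q) :
  N = (p + q)%N ->
  coboundary (cup_at N f g) =
    cup_at N.+1 (coboundary f) g
    + (fun x => (-1) ^+ p * cup_at N.+1 f (coboundary g) x).
Proof.
move=> NE; apply/funext => x.
rewrite -[RHS]/(_ x + (-1) ^+ p * _ x) /coboundary /cup_at.
pose y k := x (inord k); have xE i : x i = y i by rewrite /y inord_val.
pose F (a : nat -> nat) := f (fun i : 'I_p.+1 => y (a i)).
pose G (a : nat -> nat) := g (fun i : 'I_q.+1 => y (a i)).
have FE (a b : nat -> nat) :
  (forall i, (i < p.+1)%N -> a i = b i) -> F a = F b.
  by move=> ab; rewrite /F; congr f; apply/funext => i; rewrite ab.
have GE (a b : nat -> nat) :
  (forall i, (i < q.+1)%N -> a i = b i) -> G a = G b.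
  by move=> ab; rewrite /G; congr g; apply/funext => i; rewrite ab.
transitivity (\sum_(0 <= j < N.+2)
    (-1) ^+ j * (F (bump j) * G (fun i => bump j (p + i)%N))).
  rewrite big_mkord; apply: eq_bigr => j _; congr (_ * (_ * _)).
    congr f; apply/funext => i; rewrite xE /= inordK //.
    by rewrite NE (leq_trans (ltn_ord i)) // ltnS leq_addr.
  congr g; apply/funext => i; rewrite xE /= inordK //.
  by rewrite NE ltnS leq_add2l -ltnS.
rewrite (_ : (_ * _) + _ =
   (\sum_(0 <= j < p.+2) (-1) ^+ j * F (bump j)) * G (fun i => p.+1 + i)%N +
   (-1) ^+ p * (F id * \sum_(0 <= j < q.+2)
      (-1) ^+ j * G (fun i => (p + bump j i)%N))); last first.
  congr (_ * _ + _ * (_ * _)).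
  - rewrite big_mkord; apply: eq_bigr => j _; congr (_ * _).
  - rewrite big_mkord; apply: eq_bigr => j _; congr (_ * _).
rewrite NE (big_cat_nat (n := p.+1)) //=; last by rewrite ltnW // ltnS ltnS leq_addr.
rewrite [in RHS]big_nat_recr //= mulrDl.
rewrite (big_nat_recl q.+1) // !mulrDr expr0 mul1r.
have e1 : F (bump p.+1) = F id.
  by apply: FE => i ip; rewrite /bump leqNgt ip.
have e2 : G (fun i => p + bump 0 i)%N = G (fun i => p.+1 + i)%N.
  by apply: GE => i _; rewrite /bump leq0n add1n addnS addSn.
rewrite e1 e2 exprS mulN1r !mulrA !mulNr -addrA addKr.
congr (_ + _).
- rewrite mulr_suml; apply: eq_big_nat => j /andP[_ jp]; rewrite mulrA.
  congr (_ * _); apply: GE => i _.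
  by rewrite /bump (leq_trans _ (leq_addr i p)) // add1n addSn.
- rewrite -{1}[p.+1]add0n big_addn mulr_sumr.
  rewrite (_ : ((p + q).+2 - p.+1 = q.+1)%N); last first.
    by rewrite subSS -addnS addKn.
  apply: eq_big_nat => j _; rewrite -addSnnS exprD.
  rewrite (_ : F (bump (j.+1 + p)) = F id); last first.
    by apply: FE => i ip; rewrite /bump leqNgt (leq_trans ip) // addSn ltnS leq_addl.
  rewrite (_ : G _ = G (fun i => (p + bump j.+1 i)%N)); last first.
    by apply: GE => i _; rewrite /bump [(j.+1 + p)%N]addnC leq_add2l addnCA.
  by rewrite -!mulrA mulrCA; congr (_ * _); rewrite mulrCA.
Qed.

End Cup.

Section BoundedCohomology.
Variables (R : realType) (S : Type) (G : groupType) (act : group_action G S).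

Definition bounded_cochain n (f : cochain R S n) : Prop :=
  exists M : R, forall x, `|f x| <= M.

Definition invariant_cochain n (f : cochain R S n) : Prop :=
  forall (g : G) x, f (fun i => act g (x i)) = f x.

(* membership in C^n_{G,b}(S; R) *)
Definition Cb n (f : cochain R S n) : Prop :=
  bounded_cochain f /\ invariant_cochain f.

Definition is_Zb n (f : cochain R S n) : Prop := Cb f /\ coboundary f = 0.

Definition is_Bb n : cochain R S n -> Prop :=
  match n with
  | 0 => fun f => f = 0
  | m.+1 => fun f => exists2 h : cochain R S m, Cb h & f = coboundary h
  end.

Lemma Cb0 n : Cb (0 : cochain R S n).
Proof. by split=> //; exists 0 => x; rewrite normr0. Qed.

Lemma CbB n (f g : cochain R S n) : Cb f -> Cb g -> Cb (f - g).
Proof.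
move=> [[M fM] fi] [[N gN] gi]; split.
  by exists (M + N) => x; rewrite (le_trans (ler_normB _ _)) // lerD.
by move=> k x; rewrite -[LHS]/(f _ - g _) fi gi.
Qed.

Lemma Cb_cup_at p q N (f : cochain R S p) (g : cochain R S q) :
  Cb f -> Cb g -> Cb (cup_at N f g).
Proof.
move=> [[M fM] fi] [[K gK] gi]; split.
  by exists (M * K) => x; rewrite /cup_at normrM ler_pM.
by move=> k x; rewrite /cup_at (fi k (fun i => x (inord i)))
    (gi k (fun i => x (inord (p + i)))).
Qed.

Lemma Cb_scale n (a : R) (f : cochain R S n) : Cb f -> Cb (fun x => a * f x).
Proof.
move=> [[M fM] fi]; split; last by move=> k x; rewrite fi.
by exists (`|a| * M) => x; rewrite normrM ler_wpM2l.
Qed.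

Lemma coboundary_scale n (a : R) (f : cochain R S n) :
  coboundary (fun x => a * f x) = fun x => a * coboundary f x.
Proof.
apply/funext => x; rewrite /coboundary mulr_sumr.
by apply: eq_bigr => j _; rewrite mulrCA.
Qed.

Lemma is_Bb0 n : is_Bb (0 : cochain R S n).
Proof.
by case: n => [//|n]; exists 0; [exact: Cb0 | rewrite coboundary0].
Qed.

Lemma is_BbB n (f g : cochain R S n) : is_Bb f -> is_Bb g -> is_Bb (f - g).
Proof.
case: n f g => [f g -> ->|n f g [h hb ->] [k kb ->]]; first by rewrite subr0.
by exists (h - k); [exact: CbB | rewrite coboundaryB].
Qed.

Definition Zb_pred n : {pred cochain R S n} := [pred f | `[< is_Zb f >]].

Fact Zb_zmod_closed n : zmod_closed (@Zb_pred n).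
Proof.
split=> [|f g].
  by apply/asboolP; split; [exact: Cb0 | rewrite coboundary0].
move=> /asboolP[fb f0] /asboolP[gb g0]; apply/asboolP; split; first exact: CbB.
by rewrite coboundaryB f0 g0 subr0.
Qed.

HB.instance Definition _ n :=
  GRing.isZmodClosed.Build (cochain R S n) (@Zb_pred n) (Zb_zmod_closed n).

Record Zb (n : nat) := MkZb {
  zval :> cochain R S n;
  zvalP : zval \in @Zb_pred n }.

HB.instance Definition _ n := [isSub for @zval n].
HB.instance Definition _ n := [Choice of Zb n by <:].
HB.instance Definition _ n := [SubChoice_isSubZmodule of Zb n by <:].

Definition Bb_pred n : {pred Zb n} := [pred f : Zb n | `[< is_Bb f >]].

Fact Bb_zmod_closed n : zmod_closed (@Bb_pred n).
Proof.
split=> [|f g]; first by apply/asboolP; exact: is_Bb0.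
by move=> /asboolP fb /asboolP gb; apply/asboolP; exact: is_BbB.
Qed.

HB.instance Definition _ n :=
  GRing.isZmodClosed.Build (Zb n) (@Bb_pred n) (Bb_zmod_closed n).

Definition Hb (n : nat) : zmodType := Quotient.quot (@Bb_pred n).

Definition Hb_class n (f : Zb n) : Hb n := \pi_(Quotient.quot (@Bb_pred n)) f.

Lemma Hb_classP n (f g : Zb n) :
  Hb_class f = Hb_class g <-> is_Bb (zval f - zval g).
Proof.
split=> [/eqP|fg]; last apply/eqP.
  by rewrite /Hb_class -Quotient.idealrBE => /asboolP.
by rewrite /Hb_class -Quotient.idealrBE; apply/asboolP.
Qed.

Fact cup_Zb p q (f : Zb p) (g : Zb q) : cup f g \in @Zb_pred (p + q)%N.
Proof.
have /asboolP[fb f0] := zvalP f; have /asboolP[gb g0] := zvalP g.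
apply/asboolP; split; first exact: Cb_cup_at.
rewrite coboundary_cup_at // f0 g0; apply/funext => x.
by rewrite -[LHS]/(0 * _ + (-1) ^+ p * (_ * 0)) mul0r !mulr0 addr0.
Qed.

Definition Zb_cup p q (f : Zb p) (g : Zb q) : Zb (p + q)%N := MkZb (cup_Zb f g).

(* Defined through representatives; see [Hb_cupE]. *)
Definition Hb_cup p q (a : Hb p) (b : Hb q) : Hb (p + q)%N :=
  Hb_class (Zb_cup (repr (a : Quotient.quot (@Bb_pred p)))
                   (repr (b : Quotient.quot (@Bb_pred q)))).

Lemma is_Bb_cup_l p q (f : cochain R S p) (g : Zb q) :
  is_Bb f -> is_Bb (cup f g).
Proof.
have /asboolP[gb g0] := zvalP g.
case: p f => [|p] f.
  move=> ->; rewrite (_ : cup _ _ = 0); first exact: is_Bb0.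
  by apply/funext => x; rewrite /cup /cup_at mul0r.
move=> [h hb ->]; exists (cup h g); first exact: Cb_cup_at.
rewrite /cup coboundary_cup_at // g0; apply/funext => x.
by rewrite -[RHS]/(_ x + (-1) ^+ p * (_ * 0)) !mulr0 addr0.
Qed.

Lemma is_Bb_cup_r p q (f : Zb p) (g : cochain R S q) :
  is_Bb g -> is_Bb (cup f g).
Proof.
have /asboolP[fb f0] := zvalP f.
case: q g => [|q] g.
  move=> ->; rewrite (_ : cup _ _ = 0); first exact: is_Bb0.
  by apply/funext => x; rewrite /cup /cup_at mulr0.
move=> [h hb ->]; rewrite /cup.
move: (p + q.+1)%N (addnS p q) => [//|N] [NE].
exists (fun x => (-1) ^+ p * cup_at N f h x).
  exact/Cb_scale/Cb_cup_at.
rewrite coboundary_scale coboundary_cup_at // f0; apply/funext => x.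
rewrite -[RHS]/((-1) ^+ p * (0 * _ + (-1) ^+ p * _ x)).
by rewrite mul0r add0r mulrA -expr2 sqrr_sign mul1r.
Qed.

Lemma Hb_cupE p q (f : Zb p) (g : Zb q) :
  Hb_cup (Hb_class f) (Hb_class g) = Hb_class (Zb_cup f g).
Proof.
rewrite /Hb_cup; set f' := repr _; set g' := repr _.
have ff' : is_Bb (zval f' - zval f).
  by apply/Hb_classP; rewrite /Hb_class reprK.
have gg' : is_Bb (zval g' - zval g).
  by apply/Hb_classP; rewrite /Hb_class reprK.
apply/Hb_classP.
rewrite (_ : _ - _ = cup (zval f' - zval f) g' -
                     cup f (zval g - zval g')); last first.
  apply/funext => x.
  rewrite -[LHS]/(zval f' _ * zval g' _ - zval f _ * zval g _).
  rewrite -[RHS]/((zval f' _ - zval f _) * zval g' _ -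
    zval f _ * (zval g _ - zval g' _)).
  by rewrite mulrBl mulrBr opprB addrA subrK.
apply: is_BbB; first exact: is_Bb_cup_l.
apply: is_Bb_cup_r; rewrite -opprB -[- _]add0r.
by apply: is_BbB => //; exact: is_Bb0.
Qed.

End BoundedCohomology.

(** * CAT(0) cube complexes *)

(* Vertices of the cube {0,1}^n, and its nonempty faces. *)
Definition cube_face n (F : set {ffun 'I_n -> bool}) : Prop :=
  exists (I : {set 'I_n}) (a : {ffun 'I_n -> bool}),
    F = [set e | forall i, i \in I -> e i = a i].

(* [phi] identifies {0,1}^n with C, faces of {0,1}^n corresponding to the
   members of K contained in C. *)
Definition cube_chart (V : Type) (K : set (set V)) n
    (phi : {ffun 'I_n -> bool} -> V) (C : set V) : Prop :=
  [/\ injective phi, range phi = C &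
      forall D, D `<=` C ->
        (K D <-> exists2 F, cube_face F & D = phi @` F)].

(* Cubical complexes in the sense of Bridson-Haefliger, I.7.32: cubes are
   embedded and two of them meet, if at all, in a common face.  As for abstract
   simplicial complexes, cubes are recorded through their vertex sets. *)
Record cube_complex (V : Type) := CubeComplex {
  cubes : set (set V);
  cubes_vertex : forall v, cubes [set v];
  cubes_chart : forall C, cubes C ->
    exists n (phi : {ffun 'I_n -> bool} -> V), cube_chart cubes phi C;
  cubes_meet : forall C D, cubes C -> cubes D -> C `&` D !=set0 ->
    cubes (C `&` D) }.

Section CubeComplex.
Variables (V : Type) (X : cube_complex V).

Definition adj (a b : V) : Prop := a <> b /\ cubes X [set a; b].

Fixpoint edge_path (x : V) (p : seq V) : Prop :=
  if p is y :: p' then adj x y /\ edge_path y p' else True.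

Definition square (a b c d : V) : Prop :=
  [/\ [/\ adj a b, adj b c, adj c d & adj d a],
      a <> c, b <> d & cubes X [set v | [\/ v = a, v = b, v = c | v = d]]].

(* The moves presenting the edge-path groupoid of the 2-skeleton: removing a
   backtrack, and pushing two consecutive edges across a square. *)
Inductive elementary_homotopy : seq V -> seq V -> Prop :=
| Backtrack p a b q : adj a b ->
    elementary_homotopy (p ++ [:: a, b, a & q]) (p ++ a :: q)
| SquarePush p a b c d q : square a b c d ->
    elementary_homotopy (p ++ [:: a, b, c & q]) (p ++ [:: a, d, c & q]).

Definition edge_homotopic : seq V -> seq V -> Prop :=
  clos_refl_sym_trans (seq V) elementary_homotopy.

Definition simply_connected : Prop :=
  [/\ exists v : V, True,
      forall x y, exists2 p, edge_path x p & last x p = y &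
      forall x p, edge_path x p -> last x p = x ->
        edge_homotopic (x :: p) [:: x]].

(* The link of v: its vertices are the edges at v, encoded by their other
   endpoint, and its simplices are the corners at v of the cubes around v. *)
Definition link_simplex (v : V) (A : set V) : Prop :=
  exists C, [/\ cubes X C, C v & A = [set w | C w /\ adj v w]].

Definition flag_link (v : V) : Prop :=
  forall A : set V, finite_set A -> A `<=` adj v ->
    (forall w w', A w -> A w' -> w <> w' -> link_simplex v [set w; w']) ->
    link_simplex v A.

(* CAT(0) by Gromov's link condition. *)
Definition cat0 : Prop := simply_connected /\ forall v, flag_link v.

Definition finite_dimensional : Prop :=
  exists N : nat, forall n (phi : {ffun 'I_n -> bool} -> V) C,
    cubes X C -> cube_chart (cubes X) phi C -> (n <= N)%N.

(** ** Halfspaces *)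

(* The combinatorial metric; the junk value 0 is given to pairs of vertices
   not joined by an edge path. *)
Definition dist (x y : V) : nat :=
  let path_length n :=
    `[< exists p, [/\ size p = n, edge_path x p & last x p = y] >] in
  if pselect (exists n, path_length n) is left ex then ex_minn ex else 0%N.

Definition closer (a b : V) : set V := [set v | (dist v a < dist v b)%N].

Definition dual (a b : V) (h : set V) : Prop :=
  adj a b /\ (h = closer a b \/ h = closer b a).

Definition halfspace (h : set V) : Prop := exists a b, dual a b h.

Definition interval (x y : V) : set (set V) :=
  [set h | [/\ halfspace h, h y & (~` h) x]].

Definition transverse (h k : set V) : Prop :=
  [/\ h `&` k !=set0, (~` h) `&` k !=set0, h `&` (~` k) !=set0
    & (~` h) `&` (~` k) !=set0].

Definition staircase sigma (a b : 'I_sigma -> set V) : Prop :=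
  [/\ (forall i, halfspace (a i)) /\ (forall i, halfspace (b i)),
      forall i j : 'I_sigma, (i < j)%N -> a j `<` a i /\ b j `<` b i,
      forall i j : 'I_sigma, (j < i)%N -> transverse (a i) (b j) &
      forall i, b i `<` a i].

Definition finite_staircase_length : Prop :=
  exists N : nat, forall sigma (a b : 'I_sigma -> set V),
    staircase a b -> (sigma <= N)%N.

(** ** Segments *)

Definition tightly_nested (h k : set V) : Prop :=
  k `<` h /\
  forall h', halfspace h' -> k `<=` h' -> h' `<=` h -> h' = h \/ h' = k.

Definition segment (s : seq (set V)) : Prop :=
  [/\ (0 < size s)%N,
      forall i, (i < size s)%N -> halfspace (nth set0 s i) &
      forall i, (i.+1 < size s)%N ->
        tightly_nested (nth set0 s i) (nth set0 s i.+1)].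

(* h_1 and h_l for s = (h_1 > ... > h_l) *)
Definition seg_first (s : seq (set V)) : set V := head set0 s.
Definition seg_last (s : seq (set V)) : set V := last set0 s.

Definition is_head (s : seq (set V)) (v : V) : Prop :=
  (~` seg_first s) v /\ exists w, dual v w (seg_first s).

Definition is_tail (s : seq (set V)) (v : V) : Prop :=
  seg_last s v /\ exists w, dual v w (seg_last s).

End CubeComplex.

(** * Group actions, median quasimorphisms and non-transversality *)

Section Equivariant.
Variables (R : realType) (V : Type) (X : cube_complex V).
Variables (G : groupType) (act : group_action G V).

Definition by_automorphisms : Prop :=
  forall g C, cubes X C -> cubes X (act g @` C).

Definition translate (g : G) (s : seq (set V)) : seq (set V) :=
  [seq act g @` h | h <- s].

Definition seg_orbit (s : seq (set V)) : set (seq (set V)) :=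
  [set t | exists g, t = translate g s].

Definition nontransverse_orbits (h k : set V) : Prop :=
  ~ exists g g', transverse (act g @` h) (act g' @` k).

Definition translates_in (s : seq (set V)) (x y : V) : set (seq (set V)) :=
  [set t | seg_orbit s t /\ forall h, h \in t -> interval X x y h].

(* The sets of translates are finite, as [interval X x y] is when X is
   CAT(0). *)
Definition median_qm (s : seq (set V)) (x y : V) : R :=
  #|` fset_set (translates_in s x y)|%:R
  - #|` fset_set (translates_in s y x)|%:R.

Definition median_qm_cochain (s : seq (set V)) : cochain R V 1 :=
  fun x => median_qm s (x ord0) (x ord_max).

(* (v, x_1, ..., x_n) *)
Definition cons_vertex n (v : V) (x : 'I_n -> V) : 'I_n.+1 -> V :=
  fun i => if unlift ord0 i is Some j then x j else v.

Definition nontransverse_cochain n (k : cochain R V n) (t : seq (set V)) : Prop :=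
  forall x : 'I_n -> V,
    (forall v v', is_head X t v -> is_head X t v' ->
       k (cons_vertex v x) = k (cons_vertex v' x)) /\
    (forall v v', is_tail X t v -> is_tail X t v' ->
       k (cons_vertex v x) = k (cons_vertex v' x)).

Definition nontransverse_class n (z : Hb R act n) (T : set (seq (set V))) : Prop :=
  exists2 k : Zb R act n, Hb_class k = z &
    forall t, T t -> nontransverse_cochain k t.

End Equivariant.

(* Main.v *)
(* Idea.  For a translate t of s choose a head a_t.  As kappa is a cocycle, adding
   to f_s U kappa the coboundary of
     eta(x_0, ..., x_n) = sum_(t in [x_0, x_1]) kappa(a_t, x_1, ..., x_n)
                        - sum_(t in [x_1, x_0]) kappa(a_t, x_1, ..., x_n)
   gives, for fixed x_2, ..., x_(n+1), the coboundary of a median quasimorphism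
   whose translates are weighted by the bounded function
   t |-> kappa(a_t, x_2, ..., x_(n+1)).  Non-transversality makes eta invariant
   under the choice of heads, hence under Gamma, and the weighted quasimorphism
   has bounded defect: only the translates in [x, y] that are cut by z contribute
   at (x, y, z), and finite dimension and finite staircase length bound their
   number.  So [delta f_s] U zeta has a bounded invariant primitive.

   The geometry of halfspaces is extracted from simple connectedness and flag
   links by solving the word problem for edge paths: reduced paths with the same
   endpoints differ by pushes across squares.  This yields that the 1-skeleton is
   bipartite and satisfies the quadrangle condition. *)
Require Import Defs.
From HB Require Import structures.
From mathcomp Require Import all_boot all_order all_algebra zify lra ring.
From mathcomp Require Import finmap mathcomp_extra boolp classical_sets functions.
From mathcomp Require Import cardinality reals.
From Stdlib Require Import Relation_Operators.

Set Implicit Arguments.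
Unset Strict Implicit.
Unset Printing Implicit Defensive.

Import Order.TTheory GRing.Theory Num.Theory.

Local Open Scope ring_scope.
Local Open Scope classical_set_scope.

(** * Cubes *)

Definition flip n (e : {ffun 'I_n -> bool}) (i : 'I_n) : {ffun 'I_n -> bool} :=
  [ffun j => e j (+) (j == i)].

Lemma flipK n (e : {ffun 'I_n -> bool}) i : flip (flip e i) i = e.
Proof. by apply/ffunP => j; rewrite !ffunE -addbA addbb addbF. Qed.

Lemma flipC n (e : {ffun 'I_n -> bool}) i j :
  flip (flip e i) j = flip (flip e j) i.
Proof. by apply/ffunP => k; rewrite !ffunE addbAC. Qed.

Lemma flip_inj n (e : {ffun 'I_n -> bool}) : injective (flip e).
Proof.
move=> i j /ffunP /(_ i); rewrite !ffunE eqxx => /addbI.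
by case: eqP.
Qed.

Lemma flip_neq n (e : {ffun 'I_n -> bool}) i : flip e i <> e.
Proof.
by move=> /ffunP /(_ i); rewrite ffunE eqxx addbT; case: (e i).
Qed.

(** Flipping a coordinate changes the parity of the number of coordinates equal to [true]. *)
Lemma flip2_neq1 n (e : {ffun 'I_n -> bool}) i j k :
  flip (flip e i) j <> flip e k.
Proof.
have odd_flip (a : {ffun 'I_n -> bool}) l :
    odd #|[pred m | flip a l m]| = ~~ odd #|[pred m | a m]|.
  rewrite (cardD1 l) [in RHS](cardD1 l) !inE !ffunE eqxx addbT.
  rewrite (_ : #|[predD1 [pred m | flip a l m] & l]| =
               #|[predD1 [pred m | a m] & l]|).
    by case: (a l); rewrite /= ?add0n ?add1n ?negbK.
  by apply: eq_card => m; rewrite !inE ffunE; case: eqP; rewrite ?addbF.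
move=> E; have := odd_flip (flip e i) j; rewrite E !odd_flip.
by case: odd.
Qed.

Section CubeComplexes.
Variables (V : Type) (X : cube_complex V).

Local Notation adj := (adj X).
Local Notation square := (square X).

Lemma adj_sym a b : adj a b -> adj b a.
Proof. by move=> [ab K]; split; [exact/nesym | rewrite setUC]. Qed.

Section Charts.
Variables (n : nat) (phi : {ffun 'I_n -> bool} -> V) (C : set V).
Hypothesis chart : cube_chart (cubes X) phi C.

Let phi_inj : injective phi. Proof. by case: chart. Qed.

Let phiC e : C (phi e).
Proof. by case: chart => _ <- _; exists e. Qed.

(** Faces are cut out by fixing coordinates, so a face containing [e] and a vertex that differs from
    it at [i] also contains [flip e i]. An edge has only two vertices, so [w] is this one. *)
Lemma chart_edge e w : C w -> adj (phi e) w -> exists i, w = phi (flip e i).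
Proof.
case: chart => _ rC K Cw [ew ewK].
have /K : [set phi e; w] `<=` C by move=> _ [] ->.
case=> /(_ ewK) [F [I [a Fa]] FE] _.
have : (phi @` F) (phi e) by rewrite -FE; left.
case=> e0 Fe /phi_inj ?; subst e0.
have : (phi @` F) w by rewrite -FE; right.
case=> e' Fe' we'; have ee' : e <> e' by move=> ee'; apply: ew; rewrite ee'.
have [i ei] : exists i, e i != e' i.
  apply/existsP; rewrite -negb_forall; apply/negP => /forallP eq_e.
  by apply/ee'/ffunP => i; apply/eqP.
exists i; have : (phi @` F) (phi (flip e i)).
  exists (flip e i) => //; rewrite Fa => j jI; rewrite ffunE.
  case: eqP => [ji|_]; last by rewrite addbF; move: Fe; rewrite Fa => /(_ j jI).
  move: Fe Fe'; rewrite Fa => /(_ j jI) ea /(_ j jI) e'a.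
  by move: ei; rewrite -ji ea e'a eqxx.
by rewrite -FE => -[/phi_inj /flip_neq|].
Qed.

Lemma chart_adj e i : adj (phi e) (phi (flip e i)).
Proof.
split=> [/phi_inj/esym/flip_neq //|].
case: chart => _ rC K; apply/K; first by move=> _ [] ->.
exists [set e' | forall j, j \in [set~ i]%SET -> e' j = e j].
  by exists [set~ i]%SET, e.
apply/seteqP; split=> [_ [] -> | _ [e' /= He' <-]].
- by exists e.
- exists (flip e i) => // j; rewrite !inE => /negbTE ji.
  by rewrite ffunE ji addbF.
have [ei|ei] := eqVneq (e' i) (e i); [left|right]; congr phi; apply/ffunP => j.
  by have [->//|ji] := eqVneq j i; apply: He'; rewrite !inE.
rewrite ffunE; have [->|ji] := eqVneq j i; last first.
  by rewrite addbF; apply: He'; rewrite !inE.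
by move: ei; rewrite addbT; case: (e' i); case: (e i).
Qed.

Lemma chart_square e i j : i <> j ->
  square (phi e) (phi (flip e i)) (phi (flip (flip e i) j)) (phi (flip e j)).
Proof.
move=> ij; split.
- split; first exact: chart_adj.
  + exact: chart_adj.
  + rewrite flipC; exact/adj_sym/chart_adj.
  + exact/adj_sym/chart_adj.
- by move=> /phi_inj E; apply: ij; apply: (@flip_inj _ (flip e i)); rewrite flipK -E.
- by move=> /phi_inj/flip_inj.
case: chart => _ rC K; apply/K; first by move=> _ /= [] ->.
exists [set e' | forall k, k \in (~: [set i; j])%SET -> e' k = e k].
  by exists (~: [set i; j])%SET, e.
apply/seteqP; split=> [_ /= [] -> | _ [e' /= He' <-]].
- by exists e.
- exists (flip e i) => // k; rewrite !inE => /norP[/negbTE ki _].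
  by rewrite ffunE ki addbF.
- exists (flip (flip e i) j) => // k; rewrite !inE => /norP[/negbTE ki /negbTE kj].
  by rewrite !ffunE ki kj !addbF.
- exists (flip e j) => // k; rewrite !inE => /norP[_ /negbTE kj].
  by rewrite ffunE kj addbF.
have ext (f : {ffun 'I_n -> bool}) : (e' i = f i) -> (e' j = f j) ->
    (forall k, k != i -> k != j -> f k = e k) -> phi e' = phi f.
  move=> ei ej ek; congr phi; apply/ffunP => k.
  have [->//|ki] := eqVneq k i; have [->//|kj] := eqVneq k j.
  by rewrite ek //; apply: He'; rewrite !inE negb_or ki.
have /negbTE ij' : i != j by apply/eqP.
have ji' : (j == i) = false by rewrite eq_sym.
have [ei|ei] := eqVneq (e' i) (e i); have [ej|ej] := eqVneq (e' j) (e j).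
- by constructor 1; apply: ext.
- constructor 4; apply: ext; rewrite ?ffunE ?ij' ?eqxx ?addbF ?addbT //.
    by move: ej; case: (e' j); case: (e j).
  by move=> k _ /negbTE kj; rewrite ffunE kj addbF.
- constructor 2; apply: ext; rewrite ?ffunE ?ji' ?eqxx ?addbF ?addbT //.
    by move: ei; case: (e' i); case: (e i).
  by move=> k /negbTE ki _; rewrite ffunE ki addbF.
- constructor 3; apply: ext; rewrite ?ffunE ?ij' ?ji' ?eqxx ?addbF ?addbT //.
  + by move: ei; case: (e' i); case: (e i).
  + by move: ej; case: (e' j); case: (e j).
  + by move=> k /negbTE ki /negbTE kj; rewrite !ffunE ki kj !addbF.
Qed.

End Charts.

(** * Squares and the flag condition *)

Lemma square_rot a b c d : square a b c d -> square b c d a.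
Proof.
case=> -[ab bc cd da] ac bd K; split=> //; first exact/nesym.
by congr (cubes X _): K; apply/seteqP; split=> v /=;
  case; by [constructor 1|constructor 2|constructor 3|constructor 4].
Qed.

Lemma square_flip a b c d : square a b c d -> square a d c b.
Proof.
case=> -[ab bc cd da] ac bd K; split=> //.
- by split; apply: adj_sym.
- exact/nesym.
by congr (cubes X _): K; apply/seteqP; split=> v /=;
  case; by [constructor 1|constructor 2|constructor 3|constructor 4].
Qed.

Lemma cube_corner C v a b : cubes X C -> C v -> C a -> C b ->
  adj v a -> adj v b -> a <> b ->
  exists2 c, C c & square v a c b.
Proof.
move=> KC Cv Ca Cb va vb ab.
have [n [phi chart]] := cubes_chart KC.
have [_ rC _] := chart.
have : range phi v by rewrite rC.
case=> e _ ev; rewrite -{v}ev in Cv va vb *.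
have [i ai] := chart_edge chart Ca va.
have [j bj] := chart_edge chart Cb vb.
have ij : i <> j by move=> E; apply: ab; rewrite ai bj E.
exists (phi (flip (flip e i) j)); first by rewrite -rC; exists (flip (flip e i) j).
by rewrite ai bj; exact: (chart_square chart).
Qed.

(** Two cubes meet in a cube. If the fourth corners differed, the intersection would be [{v, a, b}],
    whereas a cube with [a], [b] adjacent to [v] contains a fourth vertex by [cube_corner]. *)
Lemma square_unique v a c b c' : square v a c b -> square v a c' b -> c = c'.
Proof.
move=> s s'; apply: contrapT => cc'.
have [[va ac cb bv] vc ab K] := s; have [[_ ac' cb' _] vc' _ K'] := s'.
set C := [set x | _] in K; set C' := [set x | _] in K'.
have KI : cubes X (C `&` C').
  by apply: cubes_meet => //; exists v; split; constructor 1.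
have IE x : (C `&` C') x -> [\/ x = v, x = a | x = b].
  move=> [/= + +]; case=> -> ; try by move=> _; constructor.
  case=> // ?; subst; by [constructor 1|constructor 2|constructor 3].
have [d Id [[vd dd' db _] vd' _ _]] : exists2 d, (C `&` C') d & square v a d b.
  apply: (cube_corner KI) => //.
  - by split; constructor 1.
  - by split; constructor 2.
  - by split; constructor 4.
  - exact: adj_sym.
case: (IE _ Id) => E.
- exact: vd'.
- by case: dd' => /(_ (esym E)).
- by case: db => /(_ E).
Qed.

(** In a chart based at [v], the neighbours of [v] flip one coordinate. If [c] were a neighbour, the
    vertex flipping both coordinates of [a] and [b] would be a fifth one, by parity. *)
Lemma square_diag_nadj v a c b : square v a c b -> ~ adj v c.
Proof.
case=> -[va ac cb bv] vc ab K vcadj.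
have [n [phi chart]] := cubes_chart K.
have [phi_inj rC _] := chart.
set C := [set x | _] in K chart rC.
have [e _ ev] : range phi v by rewrite rC; constructor 1.
have vb := adj_sym bv; rewrite -ev in va vb vcadj.
have Ci x : C x -> [\/ x = v, x = a, x = c | x = b] by [].
have Ca : C a by constructor 2.
have [i ai] := chart_edge chart Ca va.
have Cb : C b by constructor 4.
have [j bj] := chart_edge chart Cb vb.
have Cc : C c by constructor 3.
have [k ck] := chart_edge chart Cc vcadj.
have ij : i <> j by move=> E; apply: ab; rewrite ai bj E.
have : C (phi (flip (flip e i) j)) by rewrite -rC; exists (flip (flip e i) j).
case/Ci.
- rewrite -ev => /phi_inj E; apply: ij; apply: (@flip_inj _ (flip e i)).
  by rewrite flipK E.
- by rewrite ai => /phi_inj/flip2_neq1.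
- by rewrite ck => /phi_inj/flip2_neq1.
- by rewrite bj => /phi_inj/flip2_neq1.
Qed.

Lemma square_link v a c b : square v a c b -> link_simplex X v [set a; b].
Proof.
move=> s; have nadj := square_diag_nadj s.
case: s => -[va ac cb bv] vc ab K.
exists [set x | [\/ x = v, x = a, x = c | x = b]]; split=> //.
  by constructor 1.
apply/seteqP; split=> [x /= [] ->|x /= [[] -> vx]].
- by split=> //; constructor 2.
- by split; [constructor 4 | exact: adj_sym].
- by case: vx.
- by left.
- by case: nadj.
- by right.
Qed.

Hypothesis flag : forall v, flag_link X v.

Lemma link_cube v (A : set V) : finite_set A ->
  (forall w, A w -> adj v w) ->
  (forall w w', A w -> A w' -> w <> w' -> exists c, square v w c w') ->
  exists C, [/\ cubes X C, C v & A = [set w | C w /\ adj v w]].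
Proof.
move=> finA Av Asq; apply: flag => // w w' Aw Aw' ww'.
by have [c /square_link] := Asq _ _ Aw Aw' ww'.
Qed.

(** The flag condition puts the three edges at [v] in one cube. In a chart they flip three distinct
    coordinates, [square_unique] identifies the given squares with faces of this cube, and [x] has
    all three coordinates flipped. *)
Lemma cube3 v a b c ab bc ac :
  square v a ab b -> square v b bc c -> square v a ac c -> a <> c ->
  exists x, [/\ square a ab x ac, square b ab x bc & square c ac x bc].
Proof.
move=> sab sbc sac ac_neq.
have [[va _ _ /adj_sym vb] _ ab_neq _] := sab.
have [[_ _ _ /adj_sym vc] _ bc_neq _] := sbc.
have [|||C [KC Cv CE]] := @link_cube v [set x | [\/ x = a, x = b | x = c]].
- rewrite (_ : [set x | _] = [set a; b; c]); first exact: finite_set3.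
  apply/seteqP; split=> x /=.
    by case; [left; left | left; right | right].
  by case=> [[]|] ->; [constructor 1 | constructor 2 | constructor 3].
- by move=> w [] ->.
- move=> w w' [] -> [] -> // _.
  + by exists ab.
  + by exists ac.
  + by exists ab; exact/square_flip.
  + by exists bc.
  + by exists ac; exact/square_flip.
  + by exists bc; exact/square_flip.
have [n [phi chart]] := cubes_chart KC.
have [phi_inj rC _] := chart.
have [e _ ev] : range phi v by rewrite rC.
move: CE sab sbc sac va vb vc.
rewrite -{v}ev in Cv * => CE sab sbc sac va vb vc.
have [i ai] : exists i, a = phi (flip e i).
  apply: (chart_edge chart) va.
  by have [] : [set w | C w /\ adj (phi e) w] a by rewrite -CE; constructor 1.
have [j bj] : exists i, b = phi (flip e i).
  apply: (chart_edge chart) vb.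
  by have [] : [set w | C w /\ adj (phi e) w] b by rewrite -CE; constructor 2.
have [k ck] : exists i, c = phi (flip e i).
  apply: (chart_edge chart) vc.
  by have [] : [set w | C w /\ adj (phi e) w] c by rewrite -CE; constructor 3.
have ij : i <> j by move=> E; apply: ab_neq; rewrite ai bj E.
have jk : j <> k by move=> E; apply: bc_neq; rewrite bj ck E.
have ik : i <> k by move=> E; apply: ac_neq; rewrite ai ck E.
have sqE d d' f l m : l <> m -> d = phi (flip e l) -> d' = phi (flip e m) ->
    square (phi e) d f d' -> f = phi (flip (flip e l) m).
  move=> lm -> -> /square_unique; apply; exact: (chart_square chart).
rewrite (sqE _ _ _ _ _ ij ai bj sab) (sqE _ _ _ _ _ jk bj ck sbc).
rewrite (sqE _ _ _ _ _ ik ai ck sac) ai bj ck.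
exists (phi (flip (flip (flip e i) j) k)); split.
- exact: (chart_square chart).
- by rewrite [flip (flip e i) j]flipC; apply: (chart_square chart).
- rewrite [flip (flip e i) k]flipC [flip (flip e j) k]flipC.
  rewrite [flip (flip (flip e i) j) k]flipC [flip (flip e i) k]flipC.
  exact: (chart_square chart).
Qed.

End CubeComplexes.

(** * Normal forms of edge paths *)

(* Equality of edge paths up to pushing them across squares; the head of the
   list is the moving end of the path. *)
Inductive swap_equiv (V : Type) (X : cube_complex V) : seq V -> seq V -> Prop :=
| SwapNil : swap_equiv X [::] [::]
| SwapCons u P Q : swap_equiv X P Q -> swap_equiv X (u :: P) (u :: Q)
| SwapSquare u a z b R P Q : square X u a z b ->
    swap_equiv X P [:: a, z & R] -> swap_equiv X Q [:: b, z & R] ->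
    swap_equiv X (u :: P) (u :: Q).

Section NormalForms.
Variables (V : Type) (X : cube_complex V).
Hypothesis flag : forall v, flag_link X v.

Local Notation adj := (adj X).
Local Notation square := (square X).
Local Notation "P ~~ Q" := (swap_equiv X P Q) (at level 70).

Lemma swap_refl P : P ~~ P.
Proof. by elim: P => [|u P IH]; constructor. Qed.

Lemma swap_sym P Q : P ~~ Q -> Q ~~ P.
Proof.
elim=> [|u P' Q' _ IH|u a z b R P' Q' s ? _ ? _]; try by constructor.
by apply: SwapSquare (square_flip s) _ _; eassumption.
Qed.

Lemma swap_size P Q : P ~~ Q -> size P = size Q.
Proof.
by elim=> [|u P' Q' _ /= ->|u a z b R P' Q' _ _ /= -> _ ->].
Qed.

Lemma swap_consE u P Q : u :: P ~~ Q -> exists2 Q', Q = u :: Q' &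
  P ~~ Q' \/ exists a z b R,
    [/\ square u a z b, P ~~ [:: a, z & R] & Q' ~~ [:: b, z & R]].
Proof.
move=> E; inversion E as [|u' P' Q' PQ|u' a z b R P' Q' s Pa Qb]; subst.
  by exists Q' => //; left.
by exists Q' => //; right; exists a, z, b, R.
Qed.

Lemma square_neq u a z b : square u a z b ->
  [/\ u <> a, a <> z, z <> b, b <> u & u <> z /\ a <> b].
Proof. by case=> -[[? _] [? _] [? _] [? _]]. Qed.

(** Induction on the length. The critical case has a square at [u] in both hypotheses; they share
    the edge from [u] to [b]. If also [z = z'], they coincide by [square_unique]. *)
Lemma swap_trans P Q T : P ~~ Q -> Q ~~ T -> P ~~ T.
Proof.
have [n] := ubnP (size Q); elim: n P Q T => // n IHn [|u P] Q T.
  by move=> _ E; inversion E; subst.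
move=> sQ /swap_consE[Q' QE PQ]; rewrite {}QE ltnS in sQ *.
move=> /swap_consE[T' -> QT].
have IH A B C : size B = size Q' -> A ~~ B -> B ~~ C -> A ~~ C.
  by move=> sB; apply: IHn; rewrite sB.
case: PQ => [PQ|[a [z [b [R [s Pa Qb]]]]]].
  case: QT => [QT|[a [z [b [R [s Qa Tb]]]]]]; first exact/SwapCons/(IH _ _ _ _ PQ).
  by apply: SwapSquare s _ Tb; apply: IH PQ Qa.
case: QT => [QT|[b' [z' [c [R' [s' Qb' Tc]]]]]].
  by apply: SwapSquare s Pa _; apply: IH Qb => //; exact: swap_sym.
have : [:: b, z & R] ~~ [:: b', z' & R'] by apply: IH (swap_sym Qb) Qb'.
move=> /swap_consE[_ [? <-] E]; subst b'.
have sz S : size S = (size R).+2 -> size S = size Q'.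
  by move=> ->; rewrite (swap_size Qb).
case: E => [zR|[d [y [d' [S [sq zR zR']]]]]].
  have [_ [? _] _] := swap_consE zR; subst z'.
  have ac : a = c.
    apply: (@square_unique _ X b u _ z); first exact/square_rot/square_rot/square_rot.
    exact/square_rot/square_rot/square_rot/square_flip.
  subst c; apply: SwapCons; apply: (IH _ [:: a, z & R]) => //; first exact: sz.
  apply: (IH _ [:: a, z & R']); last exact: swap_sym.
    by apply: sz; have /= -> := swap_size zR.
  exact: SwapCons.
have [_ [? _] _] := swap_consE zR; subst d.
have [_ [? _] _] := swap_consE zR'; subst d'.
have ub : u <> z' by have [_ _ _ _ []] := square_neq s'.
(* Three squares now pairwise share the edges from [b] to [u], [z] and [z']. The cube they span has
   a face at [u] leading directly from [a] to [c]. *)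
have [x [s1 s2 s3]] := cube3 flag (square_rot (square_rot (square_rot s))) sq
  (square_flip (square_rot s')) ub.
have push e w S' : square w e x y -> w :: S' ~~ [:: w, y & S] ->
    [:: e, w & S'] ~~ [:: e, x, y & S].
  move=> sw wS; apply: SwapSquare wS (swap_refl _).
  exact/square_flip/square_rot.
apply: (SwapSquare s1 (R := y :: S)).
  by apply: (IH _ [:: a, z & R]) => //; [exact: sz | exact: push].
apply: (IH _ [:: c, z' & R']) => //; last exact: push.
by apply: sz; have /= -> := swap_size zR'; have /= -> := swap_size zR.
Qed.

Lemma swap_cons u P Q : u :: P ~~ u :: Q ->
  P ~~ Q \/ exists a z b R,
    [/\ square u a z b, P ~~ [:: a, z & R] & Q ~~ [:: b, z & R]].
Proof. by move=> /swap_consE[Q' [<-] E]. Qed.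

Lemma swap_head u P Q v : u :: P ~~ v :: Q -> u = v.
Proof. by move=> /swap_consE[Q' [->]]. Qed.

Lemma swap_cancel u a P Q : [:: u, a & P] ~~ [:: u, a & Q] -> a :: P ~~ a :: Q.
Proof.
case/swap_cons => // -[b [z [c [R [s /swap_head ab /swap_head ac]]]]].
by have [_ _ _ _ [_ []]] := square_neq s; rewrite -ab.
Qed.

Lemma swap_exchange u a b P Q : [:: u, a & P] ~~ [:: u, b & Q] -> a <> b ->
  exists z R, [/\ square u a z b, a :: P ~~ [:: a, z & R]
                                & b :: Q ~~ [:: b, z & R]].
Proof.
move=> /swap_cons[/swap_head //|[c [z [d [R [s aP bQ]]]]]] _.
have E1 := swap_head aP; have E2 := swap_head bQ; subst c d.
by exists z, R.
Qed.

Lemma swap_square u a z b R : square u a z b ->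
  [:: u, a, z & R] ~~ [:: u, b, z & R].
Proof. by move=> s; apply: SwapSquare s _ _; exact: swap_refl. Qed.

(** Backtracks are excluded up to swaps of the earlier part of the path, not only literally; this
    makes the notion invariant under [swap_equiv]. *)
Fixpoint reduced (P : seq V) : Prop :=
  if P is u :: P' then reduced P' /\ ~ (exists a Q, P' ~~ [:: a, u & Q])
  else True.

(** A backtrack over one of the two new sides of the square yields one over the opposite side, which
    lies on the old path. *)
Lemma reduced_square u a z b R : square u a z b ->
  reduced [:: u, a, z & R] -> reduced [:: u, b, z & R].
Proof.
move=> s [[[rR nz] na] nu]; split; first split=> //.
- move=> [c [T E]]; have ? := swap_head E; subst c.
  apply: nu; exists a, (b :: T); apply: swap_trans (swap_square _ (square_rot s)).
  exact: SwapCons.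
- move=> [c [T E]]; have ? := swap_head E; subst c.
  have [_ _ _ _ [/nesym uz _]] := square_neq s.
  have [y [S [s' zR _]]] := swap_exchange E uz.
  have := square_unique s' (square_flip (square_rot (square_rot (square_rot s)))).
  by move=> ?; subst y; apply: na; exists z, S.
Qed.

Lemma reduced_swap P Q : P ~~ Q -> reduced P <-> reduced Q.
Proof.
have tail u P' Q' : P' ~~ Q' -> (reduced P' <-> reduced Q') ->
    reduced (u :: P') -> reduced (u :: Q').
  move=> PQ rPQ [rP nP]; split; first exact/rPQ.
  by move=> [a [T QT]]; apply: nP; exists a, T; exact: swap_trans QT.
elim=> [//|u {}P {}Q PQ IH|u a z b R {}P {}Q s PaR IHP QbR IHQ].
  by split; [exact: (tail _ _ _ PQ) | exact: (tail _ _ _ (swap_sym PQ) (iff_sym IH))].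
split=> [/(tail _ _ _ PaR IHP)/(reduced_square s)|].
  exact: (tail _ _ _ (swap_sym QbR) (iff_sym IHQ)).
move=> /(tail _ _ _ QbR IHQ)/(reduced_square (square_flip s)).
exact: (tail _ _ _ (swap_sym PaR) (iff_sym IHP)).
Qed.

(* Prolong the path P by one edge, or cancel its last edge when this edge can
   be brought to the front by swaps. *)
Definition step (P : seq V) (w : V) : seq V :=
  if pselect (exists Q, exists u, P ~~ [:: u, w & Q]) is left e
  then w :: projT1 (cid e) else w :: P.

Variant step_spec P w : seq V -> Prop :=
| StepBack u Q of P ~~ [:: u, w & Q] : step_spec P w (w :: Q)
| StepForth of ~ (exists Q u, P ~~ [:: u, w & Q]) : step_spec P w (w :: P).

Lemma stepP P w : step_spec P w (step P w).
Proof.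
rewrite /step; case: pselect => [e|]; last exact: StepForth.
by case: cid => Q [u E]; exact: StepBack E.
Qed.

Lemma step_back P u w Q : P ~~ [:: u, w & Q] -> step P w ~~ w :: Q.
Proof.
move=> E; case: stepP => [u' Q' E'|[]]; last by exists Q, u.
have E2 := swap_trans (swap_sym E') E; have ? := swap_head E2; subst u'.
exact: swap_cancel E2.
Qed.

Lemma step_forth P w : ~ (exists Q u, P ~~ [:: u, w & Q]) -> step P w ~~ w :: P.
Proof. by case: stepP => [u Q E []|_ _]; [exists Q, u | exact: swap_refl]. Qed.

Lemma step_swap P Q w : P ~~ Q -> step P w ~~ step Q w.
Proof.
move=> PQ; case: (stepP Q w) => [u T QT|nQ].
  by apply: step_back; exact: swap_trans QT.
apply: swap_trans (SwapCons _ PQ); apply: step_forth => -[T [u PT]]; apply: nQ.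
by exists T, u; apply: swap_trans PT; exact: swap_sym.
Qed.

Lemma reduced_step P w : reduced P -> reduced (step P w).
Proof.
by case: stepP => [u Q /reduced_swap E /E[]|nP rP] //; split=> // -[u [Q E]];
  apply: nP; exists Q, u.
Qed.

Lemma step_head P w : exists Q, step P w = w :: Q.
Proof. by case: stepP => [u Q _|_]; eexists. Qed.

(** Reducedness matters when the step to [w] cancels: a second cancellation on the way back would
    exhibit the backtrack [u, w, u] in a path equivalent to [u :: P]. *)
Lemma stepK u P w : reduced (u :: P) -> step (step (u :: P) w) u ~~ u :: P.
Proof.
move=> rP; case: (stepP (u :: P) w) => [u' Q E|nP].
  have ? := swap_head E; subst u'.
  apply: swap_trans (swap_sym E); apply: step_forth => -[Q' [w' E']].
  have ? := swap_head E'; subst w'.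
  have /reduced_swap : u :: P ~~ [:: u, w, u & Q'].
    by apply: swap_trans E _; exact: SwapCons.
  by move=> /iffLR/(_ rP)[_ []]; exists w, Q'; exact: swap_refl.
exact: (@step_back _ w u P (swap_refl _)).
Qed.

(** Together with [stepK], this lets the edge-path groupoid act on swap classes of reduced paths.
    The cases are whether the edges from [u] to [a] and to [d] cancel; if both do, [swap_exchange]
    recovers the square [s]. *)
Lemma step_square u a b d P : square u a b d ->
  step (step (u :: P) a) b ~~ step (step (u :: P) d) b.
Proof.
(* Only the edge to [c] cancels. Then the edge to [e] is followed by a cancelling one, since
   [e, u, c] can be pushed to [e, b, c]. *)
have aux c e Q : square u c b e -> u :: P ~~ [:: u, c & Q] ->
    ~ (exists Q u', u :: P ~~ [:: u', e & Q]) ->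
    step (c :: Q) b ~~ step (e :: u :: P) b.
  move=> s E nP.
  have E' : [:: e, u & P] ~~ [:: e, b, c & Q].
    apply: swap_trans (SwapCons _ E) _; apply: swap_square.
    exact/square_rot/square_rot/square_rot.
  apply: swap_trans (swap_sym (step_back E')); apply: step_forth => -[R [c' E2]].
  have ? := swap_head E2; subst c'.
  apply: nP; exists (b :: R), u; apply: swap_trans E _.
  apply: swap_trans (SwapCons _ E2) _; exact: swap_square.
have ue c e Q u' : u :: P ~~ [:: u', c & Q] -> u :: P ~~ [:: u, c & Q].
  by move=> E; have ? := swap_head E; subst u'.
(* Neither first edge cancels. Then the second edge does not either: its cancellation would push
   across the square to one of the edge from [u] to [e]. *)
have aux2 c e : square u c b e -> ~ (exists Q u', u :: P ~~ [:: u', e & Q]) ->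
    step [:: c, u & P] b ~~ [:: b, c, u & P].
  move=> s nP; apply: step_forth => -[Q [c' E]].
  have ? := swap_head E; subst c'.
  have [_ _ _ _ [ub _]] := square_neq s.
  have [y [R [s' E' _]]] := swap_exchange E ub.
  have ye : y = e.
    by apply: (square_unique s'); exact/square_flip/square_rot.
  by subst y; apply: nP; exists R, u.
move=> s; have s' := square_flip s.
have [_ _ _ _ [ub ad]] := square_neq s.
case: (stepP (u :: P) a) => [u' Q E|na]; case: (stepP (u :: P) d) => [u'' T F|nd].
- have ? := swap_head E; have ? := swap_head F; subst u' u''.
  have [z [R [sz aQ dT]]] := swap_exchange (swap_trans (swap_sym E) F) ad.
  have ? := square_unique sz s; subst z.
  exact: swap_trans (step_back aQ) (swap_sym (step_back dT)).
- by apply: aux nd => //; exact: ue E.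
- by apply: swap_sym; apply: aux na => //; exact: ue F.
- apply: swap_trans (aux2 _ _ s nd) _; apply: swap_trans (swap_sym (aux2 _ _ s' na)).
  apply: swap_square; exact/square_flip/square_rot/square_rot.
Qed.

Definition normal_form (p : seq V) : seq V := foldr (fun w P => step P w) [::] p.

Lemma reduced_nf p : reduced (normal_form p).
Proof. by elim: p => //= w p IH; exact: reduced_step. Qed.

Lemma nf_head w p : exists Q, normal_form (w :: p) = w :: Q.
Proof. exact: step_head. Qed.

Lemma nf_cat p q q' : normal_form q ~~ normal_form q' ->
  normal_form (p ++ q) ~~ normal_form (p ++ q').
Proof. by move=> E; elim: p => //= w p IH; exact: step_swap. Qed.

Lemma nf_homotopic p q : edge_homotopic X p q -> normal_form p ~~ normal_form q.
Proof.
elim=> {p q} [p q|p|p q _|p q r _ + _]; last 3 first.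
- exact: swap_refl.
- exact: swap_sym.
- exact: swap_trans.
case=> [p' a b q' _|p' a b c d q' s]; apply: nf_cat => /=.
  have [Q E] := nf_head a q'; rewrite /= in E; have := reduced_nf (a :: q').
  by rewrite /= E; exact: stepK.
have [Q E] := nf_head c q'; rewrite /= in E; rewrite E.
apply: step_square; exact/square_flip/square_rot/square_rot.
Qed.

Lemma nf_reduced P : reduced P -> normal_form P ~~ P.
Proof.
elim: P => [_|u P IH [/IH E nP]] /=; first exact: swap_refl.
apply: swap_trans (SwapCons _ E); apply: step_forth => -[Q [a EQ]]; apply: nP.
by exists a, Q; apply: swap_trans EQ; exact: swap_sym.
Qed.

Lemma nf_catrev q A : normal_form (catrev q A) = foldl step (normal_form A) q.
Proof. by elim: q A => //= w q IH A; rewrite IH. Qed.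

(** The steps along [q] are undone, last one first. After the step to [w], induction identifies the
    path with [w :: q]; stepping back to [u] recovers [u :: A] by [stepK], and prolongs [w :: q]
    because [u :: w :: q] is reduced. *)
Lemma foldl_step_return u A q : reduced (u :: A) -> reduced (u :: q) ->
  foldl step (u :: A) q ~~ [:: last u q] -> u :: A ~~ u :: q.
Proof.
elim: q u A => [//|w q IH] u A rA rq /= E.
have [A' E'] := step_head (u :: A) w.
have AwA : w :: A' ~~ w :: q.
  by apply: IH; rewrite -?E' //; [exact: reduced_step | case: rq].
apply: swap_trans (swap_sym (stepK w rA)) _; rewrite E'.
apply: swap_trans (step_swap _ AwA) _; case: rq => _ nq.
by apply: step_forth => -[Q [w' E2]]; apply: nq; exists w', Q.
Qed.

Lemma catrev_path u p q : edge_path X u p -> edge_path X u q ->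
  exists2 L, catrev q (u :: p) = last u q :: L &
    edge_path X (last u q) L /\ last (last u q) L = last u p.
Proof.
elim: q u p => [|w q IH] u p pp /=; first by exists p.
by move=> [uw pq]; apply: IH => //; split=> //; exact: adj_sym.
Qed.

(** Running [p] backwards and then [q] gives a loop, which is null-homotopic and so has trivial
    normal form. Hence the steps along [q] reduce the normal form of [u :: p] to a point, and
    [foldl_step_return] applies. *)
Lemma reduced_unique u p q : simply_connected X ->
  edge_path X u p -> edge_path X u q -> last u p = last u q ->
  reduced (u :: p) -> reduced (u :: q) -> u :: p ~~ u :: q.
Proof.
move=> [_ _ simple] pp pq pqE rp rq.
have [L LE [pL EL]] := catrev_path pp pq.
have := nf_homotopic (simple _ _ pL (etrans EL pqE)).
rewrite -LE nf_catrev.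
have [A' E'] := nf_head u p; rewrite E'.
have -> v : normal_form [:: v] = [:: v].
  by rewrite /=; case: stepP => // v' Q F; inversion F.
have E2 : u :: A' ~~ u :: p by rewrite -E'; exact: nf_reduced.
move=> E; apply: swap_trans (swap_sym E2) _; apply: foldl_step_return => //.
exact: (iffRL (reduced_swap E2)).
Qed.

End NormalForms.

(** * Distances and halfspaces *)

Lemma exists_argmin (T : Type) (P : T -> Prop) (f : T -> nat) :
  (exists v, P v) -> exists2 v, P v & forall w, P w -> (f v <= f w)%N.
Proof.
move=> [v0 Pv0]; have ex : exists n, `[< exists2 v, P v & f v = n >].
  by exists (f v0); apply/asboolP; exists v0.
case: (ex_minnP ex) => _ /asboolP[v Pv <-] min_f.
exists v => // w Pw; apply: min_f; apply/asboolP.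
by exists w.
Qed.

Section Distance.
Variables (V : Type) (X : cube_complex V).
Hypothesis catX : cat0 X.

Local Notation adj := (adj X).
Local Notation square := (square X).
Local Notation edge_path := (edge_path X).
Local Notation d := (dist X).
Local Notation "P ~~ Q" := (swap_equiv X P Q) (at level 70).

Let flag : forall v, flag_link X v. Proof. by case: catX. Qed.
Let simple : simply_connected X. Proof. by case: catX. Qed.
Let connected x y : exists2 p, edge_path x p & last x p = y.
Proof. by case: simple. Qed.

Lemma dist_path x y : exists p, [/\ size p = d x y, edge_path x p & last x p = y].
Proof.
rewrite /dist; case: pselect => [ex|[]]; first by case: ex_minnP => m /asboolP.
by have [p pp px] := connected x y; exists (size p); apply/asboolP; exists p.
Qed.

Lemma dist_le x p : edge_path x p -> (d x (last x p) <= size p)%N.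
Proof.
move=> pp; rewrite /dist; case: pselect => [ex|//].
by case: ex_minnP => m _; apply; apply/asboolP; exists p.
Qed.

Lemma distxx x : d x x = 0%N.
Proof. by apply/eqP; rewrite -leqn0; exact: (@dist_le x [::]). Qed.

Lemma dist_eq0 x y : d x y = 0%N -> x = y.
Proof. by have [[|z p] [<- _ py]] := dist_path x y. Qed.

Lemma edge_path_cat x p q :
  edge_path x (p ++ q) <-> edge_path x p /\ edge_path (last x p) q.
Proof. by elim: p x => [|y p IH] x /=; [tauto | rewrite IH; tauto]. Qed.

Lemma dist_triangle y x z : (d x z <= d x y + d y z)%N.
Proof.
have [p [<- pp py]] := dist_path x y; have [q [<- qq qz]] := dist_path y z.
rewrite -size_cat -qz -py -last_cat; apply: dist_le; apply/edge_path_cat.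
by split=> //; rewrite py.
Qed.

Lemma dist_adj a b : adj a b -> (d a b <= 1)%N.
Proof. by move=> ab; apply: (@dist_le a [:: b]). Qed.

Lemma dist_sym x y : d x y = d y x.
Proof.
suff le u v : (d u v <= d v u)%N by apply/eqP; rewrite eqn_leq !le.
have [p [<- pp <-]] := dist_path v u.
elim: p v pp => [|w p IH] v /=; first by rewrite distxx.
move=> [vw /IH le]; apply: leq_trans (dist_triangle w _ _) _.
by have := dist_adj (adj_sym vw); lia.
Qed.

Lemma exists_toward x y : x <> y -> exists2 w, adj x w & d x y = (d w y).+1.
Proof.
have [[|w p] [ps pp py]] := dist_path x y; first by move: py => /= ->.
move: ps pp py => /= ps [xw pp] py _; exists w => //.
have := dist_le pp; rewrite py.
by have := dist_triangle w x y; have := dist_adj xw; lia.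
Qed.

Let path_of (P : seq V) := if P is u :: p then edge_path u p else True.

Let swap_path P Q : P ~~ Q ->
  (path_of P <-> path_of Q) /\ forall v, last v P = last v Q.
Proof.
have cons_path u P' Q' : P' ~~ Q' -> (path_of P' <-> path_of Q') ->
    (path_of (u :: P') <-> path_of (u :: Q')).
  case=> //= ? ? ? => [_|a z b R _ _ _] ->; tauto.
elim=> [//|u {}P {}Q PQ [IH lPQ]|u a z b R {}P {}Q s PaR [IHP lP] QbR [IHQ lQ]].
  by split; [exact: cons_path | move=> v /=; exact: lPQ].
split; last by move=> v /=; rewrite lP lQ.
have sqE : path_of [:: u, a, z & R] <-> path_of [:: u, b, z & R].
  case: s => -[ua az zb bu] _ _ _ /=.
  have bz := adj_sym zb; have ub := adj_sym bu; tauto.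
by have := cons_path u _ _ PaR IHP; have := cons_path u _ _ QbR IHQ; tauto.
Qed.

Let swap_edge_path u p v q : u :: p ~~ v :: q -> edge_path u p ->
  edge_path v q /\ last u p = last v q.
Proof. by move=> /swap_path[E /(_ u) lpq] /E. Qed.

(** Swaps preserve length and endpoints, so a backtrack brought to the front would give a
    shortcut. *)
Lemma geodesic_reduced u p :
  edge_path u p -> size p = d u (last u p) -> reduced X (u :: p).
Proof.
elim: p u => [|w p IH] u /=; first by move=> _ _; split=> // -[a [Q E]]; inversion E.
move=> [uw pp] ps.
have pw : size p = d w (last w p).
  have := dist_le pp; have := dist_triangle w u (last w p).
  by have := dist_adj uw; lia.
have := IH _ pp pw => rw; split=> // -[a [Q E]].
have ? := swap_head E; subst a.
have [[_ pQ] lE] := swap_edge_path E pp; rewrite /= in lE.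
by have := dist_le pQ; rewrite -lE; have /= := swap_size E; lia.
Qed.

(** Bipartiteness. If the distances agreed, a geodesic from [a] prolonged to [b] would be reduced,
    yet one edge longer than a geodesic from [b]; equivalent paths have equal length. *)
Lemma dist_adj_neq a b x : adj a b -> d a x <> d b x.
Proof.
move=> ab E; have [p [ps pp px]] := dist_path a x.
have [q [qs qq qx]] := dist_path b x.
have rp : reduced X [:: b, a & p].
  have rp : reduced X (a :: p) by apply: geodesic_reduced => //; rewrite px.
  split=> // -[c [Q F]]; have ? := swap_head F; subst c.
  have [[_ pQ] lE] := swap_edge_path F pp; rewrite /= px in lE.
  by have := dist_le pQ; rewrite -lE; have /= := swap_size F; lia.
have : [:: b, a & p] ~~ b :: q.
  apply: reduced_unique => //=; first by split=> //; exact: adj_sym.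
    by rewrite px qx.
  by apply: geodesic_reduced => //; rewrite qx.
by move=> /swap_size /=; lia.
Qed.

Lemma dist_adjP a b x : adj a b -> d a x = (d b x).+1 \/ d b x = (d a x).+1.
Proof.
move=> ab; have := dist_adj_neq (x := x) ab; have := dist_triangle b a x.
have := dist_triangle a b x; have := dist_adj ab; have := dist_adj (adj_sym ab).
by lia.
Qed.

(** The geodesics from [u] to [x] through [a] and through [b] are both reduced, hence equivalent,
    and [swap_exchange] finds the square at their divergence. *)
Lemma quadrangle x u a b : adj u a -> adj u b -> a <> b ->
  (d a x < d u x)%N -> (d b x < d u x)%N ->
  exists2 z, square u a z b & (d z x < d a x)%N.
Proof.
move=> ua ub ab au bu.
have [p [ps pp px]] := dist_path a x; have [q [qs qq qx]] := dist_path b x.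
have [ua1 ub1] : d u x = (d a x).+1 /\ d u x = (d b x).+1.
  by have := dist_adjP x ua; have := dist_adjP x ub; lia.
have : [:: u, a & p] ~~ [:: u, b & q].
  apply: reduced_unique => //; first by rewrite /= px qx.
    by apply: geodesic_reduced => //=; rewrite px ps ua1.
  by apply: geodesic_reduced => //=; rewrite qx qs ub1.
move=> E; have [z [R [s aR _]]] := swap_exchange E ab.
have [[_ pR] lE] := swap_edge_path aR pp; rewrite /= px in lE.
exists z => //; have := dist_le pR; rewrite -lE.
by have /= := swap_size aR; lia.
Qed.

(** * Halfspaces, gates and antichains *)

Local Notation closer := (closer X).
Local Notation halfspace := (halfspace X).
Local Notation between := (Defs.interval X).

Lemma closerP a b v : adj a b ->
  (closer a b v /\ d b v = (d a v).+1) \/ (closer b a v /\ d a v = (d b v).+1).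
Proof.
move=> ab; rewrite /Defs.closer /= !(dist_sym v).
by case: (dist_adjP v ab) => E; [right | left]; rewrite E.
Qed.

Lemma closerE a b v : closer a b v -> adj a b -> d b v = (d a v).+1.
Proof.
by move=> + /(closerP v)[[]//|[]]; rewrite /Defs.closer /=; lia.
Qed.

Lemma closer_notP a b v : adj a b -> ~ closer a b v <-> closer b a v.
Proof.
by move=> /(closerP v); rewrite /Defs.closer /=; case=> -[? _]; split => //; lia.
Qed.

Lemma closer_setC a b : adj a b -> ~` closer a b = closer b a.
Proof. by move=> ab; apply/seteqP; split=> v /(closer_notP v ab). Qed.

Lemma closer_l a b : adj a b -> closer a b a.
Proof.
by move=> ab; case: (closerP a ab) => -[//]; rewrite distxx.
Qed.

Lemma closer_r a b : adj a b -> ~ closer a b b.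
Proof. by move=> ab; rewrite (closer_notP _ ab); exact/closer_l/adj_sym. Qed.

(** If [v] saw the two parallel edges in opposite directions, [c1] and [e2] would both be nearer to
    [v] than [e1]. The quadrangle condition at [e1] then gives a fourth corner nearer still; it must
    be [c2], which is farther. *)
Lemma square_closer c c' e' e : square c c' e' e -> closer c e = closer c' e'.
Proof.
suff sub c1 c2 e2 e1 : square c1 c2 e2 e1 -> closer c1 e1 `<=` closer c2 e2.
  move=> s; apply/seteqP; split; first exact: sub.
  by apply: sub; exact/square_flip/square_rot.
move=> s v; have [[cc' ce' e21 e1c] ne _ _] := s.
have ec' := adj_sym ce'; have ee' := adj_sym e21; have ce := adj_sym e1c.
move=> /closerE/(_ ce) E; apply: contrapT => /(closer_notP v ce')/closerE/(_ ec') E'.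
have [z s' zv] : exists2 z, square e1 c1 z e2 & (d z v < d c1 v)%N.
  apply: quadrangle => //; try exact: adj_sym; try exact: nesym.
    by rewrite E.
  by have := dist_adjP v ee'; have := dist_adjP v cc'; lia.
have := square_unique s' (square_rot (square_rot (square_rot s))).
by move=> ?; subst z; have := dist_adjP v ee'; have := dist_adjP v cc'; lia.
Qed.

(** The edge from [c] to [e] is pushed across squares towards [a], each push preserving the
    halfspace, until it becomes the edge from [a] to [b]. *)
Lemma closer_parallel a b c e : adj a b -> adj c e ->
  closer c e a -> ~ closer c e b -> closer c e = closer a b.
Proof.
have [n] := ubnP (d c a); elim: n c e => // n IHn c e; rewrite ltnS => can ab ce.
move=> ca; have ae := closerE ca ce => /(closer_notP _ ce) cb.
have be := closerE cb (adj_sym ce).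
have cb1 : d c b = (d c a).+1 /\ d e b = d c a.
  have := dist_triangle a c b; have := dist_triangle b e a.
  by have := dist_adj ab; have := dist_adj (adj_sym ab); lia.
case: (pselect (c = a)) => [ca0|/exists_toward[c' cc' cE]].
  subst c; move: cb1; rewrite distxx => -[_ /dist_eq0 ->] //.
have bb : (d c' b < d c b)%N.
  by have := dist_triangle a c' b; have := dist_adj ab; lia.
have c'e : c' <> e by move=> E; subst c'; lia.
have [e' s eb] := quadrangle cc' ce c'e bb (ltac:(lia) : (d e b < d c b)%N).
have [[_ c'e' e'e _] _ _ _] := s; have ee' := adj_sym e'e.
rewrite (square_closer s); apply: IHn => //.
- by lia.
- case: (closerP a c'e') => -[] //.
  by have := dist_adjP a ee'; lia.
- rewrite (closer_notP _ c'e'); case: (closerP b (adj_sym c'e')) => -[] //.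
  by have := dist_adjP b cc'; lia.
Qed.

Lemma halfspace_closer h a b : halfspace h -> adj a b -> h a -> ~ h b ->
  h = closer a b.
Proof.
move=> [c [e [ce [] ->]]] ab ha hb; first exact: closer_parallel.
by apply: closer_parallel => //; exact: adj_sym.
Qed.

(** Every halfspace between [x] and [y] is crossed by an edge of a fixed path, and an edge with its
    direction determines the halfspace. *)
Lemma finite_interval x y : finite_set (between x y).
Proof.
have [p pp py] := connected x y; elim: p x pp py => [|w p IH] x /=.
  move=> _ ->; apply: (@sub_finite_set _ _ set0) => // h [_ hy]; exact.
move=> [xw /IH fin] py.
apply: (@sub_finite_set _ _ (closer w x |` between w y)).
  move=> h [hh hy hx]; have [hw|hw] := pselect (h w); last by right.
  by left; apply: halfspace_closer => //; exact: adj_sym.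
by rewrite finite_setU; split; [exact: finite_set1 | exact: fin].
Qed.

(** A nearest point [g] of [h] to [v] is a gate: some geodesic from any [p] in [h] to [v] passes
    through it. Induction on the distance from [p] to [g], along a geodesic [p, q, r, ...] that
    stays in [h]. *)
Lemma gate v g h : halfspace h -> h g -> (forall p, h p -> (d g v <= d p v)%N) ->
  forall p, h p -> d p v = (d g v + d p g)%N.
Proof.
move=> hh hg gmin p; have [n] := ubnP (d p g); elim: n p => // n IHn p.
rewrite ltnS => pn hp.
have toward q : h q -> q <> g -> exists r, [/\ h r, adj q r & d q g = (d r g).+1].
  move=> hq qg; have [r qr E] := exists_toward qg; exists r; split=> //.
  apply: contrapT => hr; have := halfspace_closer hh qr hq hr => hE.
  by move: hg; rewrite hE => /closerE/(_ qr); lia.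
case: (pselect (p = g)) => [->|pg]; first by rewrite distxx addn0.
have [q [hq pq E]] := toward p hp pg.
have qv : d q v = (d g v + d q g)%N by apply: IHn => //; lia.
case: (pselect (q = g)) => [qg|qg].
  subst q; move: E; rewrite distxx => ->.
  by have := gmin p hp; have := dist_adjP v pq; lia.
have [r [hr qr E']] := toward q hq qg.
have rv : d r v = (d g v + d r g)%N by apply: IHn => //; lia.
case: (dist_adjP v pq) => [|qpv]; first by lia.
have pr : p <> r by move=> ?; subst r; lia.
(* If [p] violated the formula, [p] and [r] would both be nearer to [v] than [q]. The resulting
   corner [z] lies in [h], as far from [g] as [q], so induction gives it the same distance to [v] as
   [q], which is too large. *)
have [z s zp] : exists2 z, square q p z r & (d z v < d p v)%N.
  by apply: quadrangle => //; [exact: adj_sym | lia | lia].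
have [[_ pz zr _] _ _ _] := s; have rz := adj_sym zr.
have hz : h z.
  apply: contrapT => hz; have := halfspace_closer hh pz hp hz.
  rewrite (square_closer (square_rot (square_rot (square_rot (square_flip s))))).
  by move=> hE; move: hr; rewrite hE; exact: closer_r.
have zg : d z g = d q g by have := dist_adjP g pz; have := dist_adjP g rz; lia.
by have : d z v = (d g v + d z g)%N by [apply: IHn => //; lia]; lia.
Qed.

(** The vertex [w] is the first one on a geodesic from [v] to its gate in [h]. *)
Lemma gate_step v h : halfspace h -> ~ h v ->
  exists2 w, adj v w & h `<=` closer w v.
Proof.
move=> hh hv.
have [g hg gmin] : exists2 g, h g & forall p, h p -> (d g v <= d p v)%N.
  apply: exists_argmin; case: hh => a [b [ab [] ->]].
    by exists a; exact: closer_l.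
  by exists b; exact/closer_l/adj_sym.
have vg : v <> g by move=> ?; subst g.
have [w vw E] := exists_toward vg; exists w => // p hp.
have := gate hh hg gmin hp; have := dist_triangle g w p.
by rewrite /Defs.closer /= !(dist_sym p) (dist_sym g v) (dist_sym g p); lia.
Qed.

(** The antichain is realised by edges at a single vertex [v], outside all its members and nearest
    to [y]. These edges all lead towards [y], so they pairwise span squares by [quadrangle], hence a
    cube by flagness, whose dimension bounds their number. *)
Lemma antichain_bound : finite_dimensional X ->
  exists N : nat, forall x y (hs : seq (set V)), uniq hs ->
    (forall h, h \in hs -> between x y h) ->
    (forall h k, h \in hs -> k \in hs -> h `<=` k -> h = k) ->
    (size hs <= N)%N.
Proof.
move=> [N dimN]; exists N => x y hs uhs hsxy anti.
have [v vhs vmin] : exists2 v, (forall h, h \in hs -> ~ h v) &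
    forall w, (forall h, h \in hs -> ~ h w) -> (d v y <= d w y)%N.
  by apply: exists_argmin; exists x => h /hsxy[].
(* The edge given by [gate_step] enters some member [k] by minimality of [v]. It is dual to [k], so
   [h] is contained in [k] and the antichain condition gives [h = k]. *)
have /choice[W WP] : forall h, exists w, h \in hs -> adj v w /\ h = closer w v.
  move=> h; case: (boolP (h \in hs)) => [hhs|]; last by exists v.
  have [hh hy _] := hsxy _ hhs.
  have [w vw hw] := gate_step hh (vhs _ hhs); exists w => _; split=> //.
  have wy : (d w y < d v y)%N by have := closerE (hw _ hy) (adj_sym vw); lia.
  have [k khs kw] : exists2 k, k \in hs & k w.
    apply: contrapT => nk; have : (d v y <= d w y)%N.
      by apply: vmin => h' h'hs h'w; apply: nk; exists h'.
    by rewrite leqNgt wy.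
  have [hk _ _] := hsxy _ khs.
  have kE := halfspace_closer hk (adj_sym vw) kw (vhs _ khs).
  by rewrite -kE; apply: anti => //; rewrite kE.
have [|||C [KC Cv CE]] := @link_cube _ X flag v [set W h | h in [set` hs]].
- exact/finite_image/finite_seq.
- by move=> _ [h /= /WP[vw _] <-].
- move=> _ _ [h /= hhs <-] [k /= khs <-] ne.
  have [vh hE] := WP _ hhs; have [vk kE] := WP _ khs.
  have [_ hy _] := hsxy _ hhs; have [_ ky _] := hsxy _ khs.
  have [||z s _] := quadrangle vh vk ne (x := y); last by exists z.
  + by move: hy; rewrite {1}hE => /closerE/(_ (adj_sym vh)); lia.
  + by move: ky; rewrite {1}kE => /closerE/(_ (adj_sym vk)); lia.
have [n [phi chart]] := cubes_chart KC.
apply: leq_trans (dimN _ _ _ KC chart).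
have [_ rC _] := chart.
have [e _ ev] : range phi v by rewrite rC.
have [h0|] := eqVneq (size hs) 0%N; first by rewrite h0.
case: hs uhs hsxy anti vhs vmin WP CE => // h0 hs'; set hs := h0 :: hs'.
move=> uhs hsxy anti vhs vmin WP CE _.
have Wv h : h \in hs -> exists i, W h = phi (flip e i).
  move=> hhs; have [Ch vh] : [set w | C w /\ adj v w] (W h) by rewrite -CE; exists h.
  by rewrite -ev in vh; exact: (chart_edge chart Ch vh).
have [i0 _] := Wv h0 (mem_head _ _).
have /choice[I IP] : forall h, exists i, h \in hs -> W h = phi (flip e i).
  move=> h; case: (boolP (h \in hs)) => [/Wv[i iE]|]; first by exists i.
  by exists i0.
rewrite -(size_map I) -[n in (_ <= n)%N]card_ord.
suff /card_uniqP <- : uniq (map I hs) by exact: max_card.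
rewrite map_inj_in_uniq // => h k hhs khs E.
have [_ ->] := WP _ hhs; have [_ ->] := WP _ khs.
by rewrite (IP _ hhs) (IP _ khs) E.
Qed.

End Distance.

(** * Counting chains of halfspaces *)

(** Mirsky's argument: discarding the minimal elements removes at most [N] of them, and a chain in
    the remainder can be prolonged below its first element. *)
Lemma chain_of_large (T : eqType) (r : rel T) (N L : nat) (S : seq T) :
  uniq S ->
  (forall A, uniq A -> {subset A <= S} -> {in A &, forall a b, ~~ r a b} ->
     (size A <= N)%N) ->
  (N * L < size S)%N ->
  exists C, [/\ size C = L.+1, sorted r C & {subset C <= S}].
Proof.
elim: L S => [|L IH] S uS anti.
  case: S uS anti => [|a S] // _ _ _; exists [:: a]; split=> // b.
  by rewrite !inE => ->.
move=> SL; pose minimal a := ~~ has (r^~ a) S.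
have minN : (size (filter minimal S) <= N)%N.
  apply: anti; first exact: filter_uniq.
    by move=> a; rewrite mem_filter => /andP[].
  move=> a b; rewrite !mem_filter => /andP[_ aS] /andP[bmin _].
  by apply: contra bmin => rab; apply/hasP; exists a.
have [|||C [sC rC CS]] := IH (filter (predC minimal) S).
- exact: filter_uniq.
- move=> A uA AS; apply: anti => // a /AS.
  by rewrite mem_filter => /andP[].
- rewrite size_filter; have := count_predC minimal S; move: minN.
  by rewrite size_filter; lia.
case: C sC rC CS => // a C sC rC CS.
have := CS a (mem_head _ _); rewrite mem_filter /= negbK => /andP[/hasP[b bS rba] _].
exists [:: b, a & C]; split; first by rewrite /= in sC *; rewrite sC.
  by rewrite /= rba.
move=> c; rewrite inE => /predU1P[->//|/CS].
by rewrite mem_filter => /andP[].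
Qed.

Lemma size_fibers (T U : eqType) (f : T -> U) (N : nat) (P : seq T) :
  (forall k, size [seq p <- P | f p == k] <= N)%N ->
  (size P <= N * size (undup (map f P)))%N.
Proof.
move=> fib; have : {in P, forall p, f p \in undup (map f P)}.
  by move=> p pP; rewrite mem_undup map_f.
move: (undup (map f P)) => keys; elim: keys P fib => [|k keys IH] P fib Pkeys.
  by case: P Pkeys {fib} => // p P /(_ p (mem_head _ _)).
rewrite -(count_predC (fun p => f p == k)) mulnS leq_add -?size_filter //.
apply: IH => [k'|p].
  rewrite -filter_predI (leq_trans _ (fib k')) // !size_filter.
  by apply: sub_count => p /= /andP[].
rewrite mem_filter /= => /andP[pk /Pkeys]; by rewrite inE (negbTE pk).
Qed.

Lemma sorted_comparable (T : eqType) (r : rel T) (C : seq T) a b :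
  transitive r -> sorted r C -> a \in C -> b \in C -> [\/ a = b, r a b | r b a].
Proof.
move=> tr; elim: C => //= c C IH pC.
have cC : {in C, forall e, r c e} by apply/allP; exact: order_path_min pC.
rewrite !inE => /predU1P[->|aC] /predU1P[->|bC].
- by constructor 1.
- by constructor 2; apply: cC.
- by constructor 3; apply: cC.
- by apply: IH => //; exact: path_sorted pC.
Qed.

Section Counting.
Variables (V : Type) (X : cube_complex V).
Hypotheses (catX : cat0 X) (dimX : finite_dimensional X)
  (stairX : finite_staircase_length X).

Local Notation between := (Defs.interval X).
Local Notation tight := (tightly_nested X).

Fixpoint tight_chain (h : set V) (t : seq (set V)) : Prop :=
  if t is k :: t' then tight h k /\ tight_chain k t' else True.

(** The immediate successors of a halfspace form an antichain, so [antichain_bound] limits the ways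
    to continue a tight chain. *)
Lemma tight_below_anti h k k' : halfspace X k' -> tight h k -> tight h k' ->
  k `<=` k' -> k = k'.
Proof.
move=> hk' [_ hk] [[k'h nk'h] _] kk'; have [kh|//] := hk _ hk' kk' k'h.
by case: nk'h; rewrite kh.
Qed.

Lemma tight_above_anti h h' k : halfspace X h -> tight h k -> tight h' k ->
  h `<=` h' -> h = h'.
Proof.
move=> hh [[kh nkh] _] [_ hk] hh'; have [//|kh'] := hk _ hh kh hh'.
by case: nkh; rewrite kh'.
Qed.

Lemma tight_chains_bound : exists N : nat, forall l x y h (P : seq (seq (set V))),
  uniq P ->
  (forall t, t \in P -> [/\ size t = l, tight_chain h t &
                            forall k, k \in t -> between x y k]) ->
  (size P <= N ^ l)%N.
Proof.
have [N antiN] := antichain_bound catX dimX.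
exists N; elim=> [|l IH] x y h P uP tP.
  rewrite expn0; have : {subset P <= [:: [::]]}.
    by move=> t /tP[/size0nil ->].
  by move=> /(uniq_leq_size uP).
rewrite expnS mulnC.
apply: leq_trans (_ : N ^ l * size (undup (map (head set0) P)) <= _)%N.
  apply: size_fibers => k; set P' := filter _ _.
  have P'P t : t \in P' -> t = k :: behead t /\ t \in P.
    rewrite mem_filter => /andP[/eqP tk tinP]; split=> //.
    by have [st _ _] := tP _ tinP; case: t tk tinP st => //= a t ->.
  rewrite -(size_map behead); apply: (IH x y k).
    rewrite map_inj_in_uniq; first exact: filter_uniq.
    by move=> t t' /P'P[-> _] /P'P[-> _] /= ->.
  move=> _ /mapP[t /P'P[tE /tP[st ht xy]] ->]; move: st ht xy; rewrite tE /=.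
  move=> -[st] [_ ht] xy; split=> // k' k't; apply: xy.
  by rewrite inE k't orbT.
rewrite leq_mul2l (antiN x y _ (undup_uniq _)) ?orbT //.
- move=> k; rewrite mem_undup => /mapP[t /tP[st _ xy] ->].
  by apply: xy; case: t st => //= a t _; rewrite mem_head.
- move=> k k'; rewrite !mem_undup => /mapP[t /tP[st ht _] ->].
  move=> /mapP[t' /tP[st' ht' xy'] ->].
  case: t st ht => // a t _ [ha _]; case: t' st' ht' xy' => // a' t' _ [ha' _] xy'.
  by apply: tight_below_anti ha ha'; have [] := xy' a' (mem_head _ _).
Qed.

(** Each outer halfspace has at most [N] inner partners. More than [N * (N * L)] outer ones would
    contain a chain of [N * L + 1], and within it a chain of [L + 1] whose inner partners also
    decrease: a staircase that is too long. *)
Lemma tight_pairs_bound : exists M : nat, forall x y z (P : seq (set V * set V)),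
  uniq P ->
  (forall p, p \in P -> [/\ between x y p.1, between x y p.2, p.1 z, ~ p.2 z
                          & tight p.1 p.2]) ->
  (size P <= M)%N.
Proof.
have [N antiN] := antichain_bound catX dimX; have [L stairL] := stairX.
exists (N * (N * (N * L)))%N => x y z P uP PP.
apply: leq_trans (_ : N * size (undup (map fst P)) <= _)%N.
  apply: size_fibers => a; set P' := filter _ _.
  have P'P p : p \in P' -> p = (a, p.2) /\ p \in P.
    by rewrite mem_filter => /andP[/eqP <- pP]; split=> //; case: p {pP}.
  rewrite -(size_map snd); apply: (antiN x y).
  - rewrite map_inj_in_uniq; first exact: filter_uniq.
    by move=> p p' /P'P[-> _] /P'P[-> _] /= ->.
  - by move=> _ /mapP[p /P'P[_ /PP[_ ? _ _ _]] ->].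
  - move=> h k /mapP[p /P'P[pE /PP[_ _ _ _ pt]] ->].
    move=> /mapP[p' /P'P[pE' /PP[_ [? _ _] _ _ pt']] ->].
    by rewrite pE /= in pt; rewrite pE' /= in pt'; exact: tight_below_anti pt pt'.
rewrite leq_mul2l; apply/orP; right; rewrite leqNgt; apply/negP.
set A := undup _ => sA.
have /choice[b bP] : forall a, exists b, a \in A -> (a, b) \in P.
  move=> a; case: (boolP (a \in A)) => [|_]; last by exists set0.
  by rewrite mem_undup => /mapP[[a' b'] ? /= ->]; exists b'.
have {PP bP}abP a : a \in A -> [/\ between x y a, between x y (b a), a z,
    ~ b a z & tight a (b a)] by move=> /bP/PP.
pose r : rel (set V) := fun a a' => `[< a' `<` a >].
have r_trans : transitive r.
  move=> a' a a'' /asboolP[a'a na'a] /asboolP[a''a' na''a']; apply/asboolP.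
  by split=> [|aa'']; [exact: subset_trans a'a | exact/na'a/(subset_trans aa'')].
(* By tightness, [a'] would equal [a] or [b a]; the first contradicts strictness, the second that
   [z] lies in [a'] but not in [b a]. *)
have b_notin a a' : a \in A -> a' \in A -> r a a' -> ~ (b a `<=` a').
  move=> /abP[_ _ _ baz [_ at_]] /abP[[ha' _ _] _ a'z _ _] /asboolP[a'a na'a] ba.
  by have [E|E] := at_ _ ha' ba a'a; [apply: na'a; rewrite E | apply: baz; rewrite -E].
have b_anti a a' : a \in A -> a' \in A -> r a a' -> ~ (b a `<=` b a').
  move=> aA a'A raa' bb; apply: (b_notin a a' aA a'A raa').
  by apply: subset_trans bb _; have [_ _ _ _ [[]]] := abP _ a'A.
have proper_of (h k : set V) : h `<=` k -> h <> k -> h `<` k.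
  by move=> hk ne; split=> // kh; apply: ne; exact/seteqP.
have [C [sC rC CA]] : exists C,
    [/\ size C = (N * L).+1, sorted r C & {subset C <= A}].
  apply: chain_of_large sA; first exact: undup_uniq.
  move=> B uB BA nr; apply: (antiN x y) => // [h /BA/abP[]//|h k hB kB hk].
  apply: contrapT => hk_neq; have /negP := nr _ _ kB hB; apply.
  exact/asboolP/proper_of.
pose r2 : rel (set V) := fun a a' => r a a' && `[< b a' `<` b a >].
have r2_trans : transitive r2.
  move=> a' a a'' /andP[r1 /asboolP[b1 nb1]] /andP[r1' /asboolP[b2 nb2]].
  rewrite /r2 (r_trans _ _ _ r1 r1') /=; apply/asboolP.
  by split=> [|bb]; [exact: subset_trans b1 | exact/nb1/(subset_trans bb)].
have uC : uniq C.
  apply: sorted_uniq rC => // a; apply/asboolP => -[_]; exact.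
(* Along [C] a larger outer halfspace never has a smaller inner one. So elements without
   [r2]-related pairs have distinct, incomparable inner partners. *)
have [D [sD rD DC]] : exists D,
    [/\ size D = L.+1, sorted r2 D & {subset D <= C}].
  apply: (chain_of_large (N := N)) => //; last by rewrite sC.
  move=> B uB BC nr; rewrite -(size_map b).
  have cmp a a' : a \in B -> a' \in B -> [\/ a = a', r a a' | r a' a].
    by move=> /BC aC /BC a'C; exact: sorted_comparable rC aC a'C.
  have BA a : a \in B -> a \in A by move=> /BC/CA.
  apply: (antiN x y).
  - rewrite map_inj_in_uniq // => a a' aB a'B E.
    case: (cmp _ _ aB a'B) => // raa'.
      by case: (b_anti _ _ (BA _ aB) (BA _ a'B) raa'); rewrite E.
    by case: (b_anti _ _ (BA _ a'B) (BA _ aB) raa'); rewrite E.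
  - by move=> _ /mapP[a /BA/abP[_ ? _ _ _] ->].
  move=> h k /mapP[a aB ->] /mapP[a' a'B ->] bb.
  case: (cmp _ _ aB a'B) => [->//|raa'|raa'].
    by case: (b_anti _ _ (BA _ aB) (BA _ a'B) raa').
  apply: contrapT => ne; have /negP := nr _ _ a'B aB; apply.
  by rewrite /r2 raa' /=; exact/asboolP/proper_of.
suff : (L.+1 <= L)%N by rewrite ltnn.
have DA i : (i < L.+1)%N -> nth set0 D i \in A.
  by move=> iL; apply/CA/DC/mem_nth; rewrite sD.
have rDij i j : (i < j)%N -> (j < L.+1)%N -> r2 (nth set0 D i) (nth set0 D j).
  move=> ij jL; apply: sorted_ltn_nth => //; rewrite inE sD //.
  exact: ltn_trans ij jL.
(* For transversality the four corners are witnessed by [y], a point of the earlier [b] outside the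
   later [a] (from [b_notin]), [z], and [x]. *)
apply: (stairL L.+1 (fun i => nth set0 D i) (fun i => b (nth set0 D i))); split.
- by split=> i; have [[? _ _] [? _ _] _ _ _] := abP _ (DA i (ltn_ord i)).
- by move=> i j ij; have /andP[/asboolP ? /asboolP ?] := rDij i j ij (ltn_ord j).
- move=> j i ij; have /andP[rij _] := rDij i j ij (ltn_ord j).
  have iA := DA i (ltn_ord i); have jA := DA j (ltn_ord j).
  have [_ [_ byi bxi] _ bzi _] := abP _ iA; have [[_ ayj axj] _ azj _ _] := abP _ jA.
  split; [by exists y | | by exists z | by exists x].
  have /existsNP[v] := b_notin _ _ iA jA rij; move=> /not_implyP[bv av].
  by exists v.
- by move=> i; have [_ _ _ _ []] := abP _ (DA i (ltn_ord i)).
Qed.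

(** If the second halfspace still contains [z], the tail is a shorter cut chain with at most [N]
    possible predecessors. Otherwise the first two halfspaces are a tight pair cut by [z], with
    boundedly many continuations; this gives the two summands of the constant. *)
Lemma cut_chains_bound l : exists C : nat, forall x y z (P : seq (seq (set V))),
  uniq P ->
  (forall t, t \in P -> [/\ size t = l, tight_chain (head set0 t) (behead t),
     forall k, k \in t -> between x y k, head set0 t z & ~ last set0 t z]) ->
  (size P <= C)%N.
Proof.
have [N antiN] := antichain_bound catX dimX.
have [N' chainN] := tight_chains_bound; have [M pairM] := tight_pairs_bound.
elim: l => [|l [C IH]].
  (* The empty chain is excluded because its default first halfspace [set0] does not contain [z]. *)
  exists 0%N => x y z [//|t P] _ /(_ t (mem_head _ _)) [/size0nil -> _ _ []].
exists (N * C + N' ^ l.-1 * M)%N => x y z P uP PP.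
have {PP}PP t : t \in P -> exists h k t', [/\ t = [:: h, k & t'], l = (size t').+1,
    tight h k /\ tight_chain k t', forall k', k' \in t -> between x y k'
    & h z /\ ~ last k t' z].
  move=> /PP; case: t => [[]//|h [|k t']] [[st] ht xy hz lz] //.
  by exists h, k, t'.
pose inside (t : seq (set V)) := `[< head set0 (behead t) z >].
rewrite -(count_predC inside) leq_add // -size_filter; set P' := filter _ _.
  apply: leq_trans (_ : N * size (undup (map behead P')) <= _)%N.
    apply: size_fibers => u; rewrite -(size_map (head set0)).
    have PE t : t \in [seq p <- P' | behead p == u] ->
        t = head set0 t :: u /\ t \in P.
      rewrite !mem_filter => /and3P[/eqP <- _ /[dup] tP /PP[h [k [t' [tE _ _ _ _]]]]].
      by rewrite {1 2 3}tE.
    apply: (antiN x y).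
    - rewrite map_inj_in_uniq; first exact/filter_uniq/filter_uniq.
      by move=> t t' /PE[-> _] /PE[-> _] /= ->.
    - move=> _ /mapP[t /PE[_ /PP[h [k [t' [-> _ _ xy _]]]]] ->].
      by apply: xy; rewrite mem_head.
    - move=> h1 h2 /mapP[t1 /PE[tu /PP[h [k [t [E _ [hk _] xy _]]]]] ->].
      move=> /mapP[t2 /PE[tu' /PP[h' [k' [t' [E' _ [hk' _] _ _]]]]] ->].
      move: tu tu'; rewrite E E' /= => -[<-] [? _]; subst k'.
      by apply: tight_above_anti hk hk'; have [] := xy h; rewrite // E mem_head.
  rewrite leq_mul2l (IH x y z) ?orbT // ?undup_uniq // => u.
  rewrite mem_undup => /mapP[t]; rewrite mem_filter => /andP[/asboolP tz].
  move=> /PP[h [k [t' [E -> [_ kt'] xy [_ lz]]]]] ->; move: tz; rewrite E /= => kz.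
  split=> // k' k't'; apply: xy; by rewrite E inE k't' orbT.
apply: leq_trans (_ : N' ^ l.-1 *
    size (undup (map (fun t => (head set0 t, head set0 (behead t))) P')) <= _)%N.
  apply: size_fibers => -[h k]; rewrite -(size_map (behead \o behead)).
  have PE t : t \in [seq p <- P' | (head set0 p, head set0 (behead p)) == (h, k)] ->
      t = [:: h, k & behead (behead t)] /\ t \in P.
    rewrite !mem_filter => /and3P[/eqP[<- <-] _ /[dup] tP].
    by move=> /PP[h' [k' [t' [tE _ _ _ _]]]]; rewrite {1 2 3 4}tE.
  apply: (chainN _ x y k).
    rewrite map_inj_in_uniq; first exact/filter_uniq/filter_uniq.
    by move=> t t' /PE[-> _] /PE[-> _] /= ->.
  move=> _ /mapP[t /PE[tE /PP[h' [k' [t' [E -> [_ kt'] xy _]]]]] ->].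
  move: tE; rewrite E /= => -[_ <-]; split=> // k1 k1t; apply: xy.
  by rewrite E !inE k1t !orbT.
rewrite leq_mul2l (pairM x y z) ?orbT // ?undup_uniq // => p.
rewrite mem_undup => /mapP[t]; rewrite mem_filter => /andP[/= /asboolP tz].
move=> /PP[h [k [t' [E _ [hk _] xy [hz _]]]]] ->; move: tz; rewrite E /= => kz.
by split=> //; apply: xy; rewrite E !inE eqxx ?orbT.
Qed.

End Counting.

(** * Cochains and automorphisms *)

Section Cochains.
Variables (R : realType) (S : Type).

Lemma coboundaryD n (f g : cochain R S n) :
  coboundary (f + g) = coboundary f + coboundary g.
Proof.
apply/funext => x; rewrite -[RHS]/(coboundary f x + coboundary g x).
by rewrite /coboundary -big_split; apply: eq_bigr => j _; exact: mulrDr.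
Qed.

(** The cancellation behind the vanishing of the double coboundary: [(j, i)] with [j <= i] is paired
    with [(i + 1, j)]. Each induction step adds one row and one column that cancel. *)
Lemma alternating_sum0 (H : nat -> nat -> R) m :
  (forall i j, (j <= i)%N -> H j i = - H i.+1 j) ->
  \sum_(j < m.+1) \sum_(i < m) H j i = 0.
Proof.
move=> HE; elim: m => [|m IH]; first by rewrite big1 // => j _; rewrite big_ord0.
rewrite big_ord_recr /=; under eq_bigr do rewrite big_ord_recr /=.
rewrite big_split /= IH add0r -big_split big1 //= => j _.
by rewrite HE ?addNr // -ltnS.
Qed.

Lemma coboundaryK n (f : cochain R S n) : coboundary (coboundary f) = 0.
Proof.
apply/funext => x; rewrite -[RHS]/0.
pose H j i := (-1) ^+ (j + i) *
  f (fun k : 'I_n.+1 => x (inord (bump j (bump i k)))).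
rewrite -[RHS](@alternating_sum0 H n.+2).
  apply: eq_bigr => j _; rewrite /coboundary mulr_sumr; apply: eq_bigr => i _.
  rewrite mulrA -exprD; congr (_ * f _); apply/funext => k; congr x.
  by apply: val_inj; rewrite /= inordK //; exact: (valP (lift j (lift i k))).
move=> i j ji; rewrite /H addSn exprS mulN1r mulNr opprK addnC; congr (_ * f _).
apply/funext => k; congr (x (inord _)); rewrite /bump.
by case: (leqP i k); case: (leqP j k); lia.
Qed.

End Cochains.

(** * Action of automorphisms on halfspaces, segments and intervals *)

Section Automorphisms.
Variables (V : Type) (X : cube_complex V) (G : groupType) (act : group_action G V).
Hypotheses (catX : cat0 X) (aut : by_automorphisms X act).

Lemma gactK g x : act g^-1%g (act g x) = x.
Proof. by rewrite -gactM mulVg gact1. Qed.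

Lemma gactVK g x : act g (act g^-1%g x) = x.
Proof. by rewrite -gactM mulgV gact1. Qed.

Lemma gact_inj g : injective (act g).
Proof. exact: can_inj (gactK g). Qed.

Lemma image_gact g (h : set V) v : (act g @` h) (act g v) <-> h v.
Proof. by split=> [[w hw /gact_inj <-]|hv]; [|exists v]. Qed.

Lemma image_gactE g (h : set V) v : (act g @` h) v <-> h (act g^-1%g v).
Proof. by rewrite -{1}(gactVK g v) image_gact. Qed.

Lemma image_gactK g (h : set V) : act g^-1%g @` (act g @` h) = h.
Proof.
by apply/seteqP; split=> v; rewrite !image_gactE invgK gactK.
Qed.

Lemma image_gactVK g (h : set V) : act g @` (act g^-1%g @` h) = h.
Proof. by have := image_gactK g^-1%g h; rewrite invgK. Qed.

Lemma adj_gact g a b : adj X a b -> adj X (act g a) (act g b).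
Proof.
move=> [ab /(@aut g)]; rewrite image_setU !image_set1 => K; split=> //.
by move=> /gact_inj.
Qed.

Lemma dist_gact g x y : dist X (act g x) (act g y) = dist X x y.
Proof.
suff le k u v : (dist X (act k u) (act k v) <= dist X u v)%N.
  by apply/eqP; rewrite eqn_leq le -{1}(gactK g x) -{1}(gactK g y) le.
have [p [<- pp <-]] := dist_path catX u v.
have [pp' <-] : edge_path X (act k u) (map (act k) p) /\
    last (act k u) (map (act k) p) = act k (last u p).
  split; last by rewrite last_map.
  by elim: p u pp => //= w p IH u [uw /IH]; split=> //; exact: adj_gact.
by rewrite (leq_trans (dist_le pp')) // size_map.
Qed.

Lemma closer_gact g a b : act g @` closer X a b = closer X (act g a) (act g b).
Proof.
apply/seteqP; split=> v; rewrite image_gactE /closer /=.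
  by rewrite -(dist_gact g) -(dist_gact g _ b) !gactVK.
by rewrite -(dist_gact g _ a) -(dist_gact g _ b) !gactVK.
Qed.

Lemma dual_gact g a b h : dual X a b h -> dual X (act g a) (act g b) (act g @` h).
Proof.
move=> [ab hE]; split; first exact: adj_gact.
by case: hE => ->; rewrite closer_gact; [left | right].
Qed.

Lemma halfspace_gact g h : halfspace X h -> halfspace X (act g @` h).
Proof. by move=> [a [b /(dual_gact g) D]]; exists (act g a), (act g b). Qed.

Lemma tightly_nested_gact g h k :
  tightly_nested X h k -> tightly_nested X (act g @` h) (act g @` k).
Proof.
move=> [[kh nhk] hk]; split.
  split; first exact: image_subset.
  move=> /(@image_subset _ _ (act g^-1%g)); rewrite !image_gactK; exact: nhk.
move=> h' hh' /(@image_subset _ _ (act g^-1%g)) + /(@image_subset _ _ (act g^-1%g)).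
rewrite !image_gactK => kh' h'h.
by have [<-|<-] := hk _ (halfspace_gact g^-1 hh') kh' h'h;
  rewrite image_gactVK; [left | right].
Qed.

Lemma segment_translate g s : segment X s -> segment X (translate act g s).
Proof.
move=> [s0 sh st]; rewrite /segment size_map; split=> // i ilt.
  by rewrite (nth_map set0) //; exact/halfspace_gact/sh.
rewrite !(nth_map set0) //; last exact: ltnW.
exact/tightly_nested_gact/st.
Qed.

Lemma segment_orbit s t : segment X s -> seg_orbit act s t -> segment X t.
Proof. by move=> segs [g ->]; exact: segment_translate. Qed.

Lemma translateK g : cancel (translate act g) (translate act g^-1%g).
Proof.
move=> s; rewrite /translate -map_comp -[RHS]map_id; apply: eq_map => h /=.
exact: image_gactK.
Qed.

Lemma seg_orbit_translate g s t :
  seg_orbit act s t -> seg_orbit act s (translate act g t).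
Proof.
move=> [k ->]; exists (g * k)%g; rewrite /translate -map_comp; apply: eq_map => h.
by rewrite /= image_comp; apply: eq_imagel => v _; rewrite /= gactM.
Qed.

Lemma head_translate g s : s != [::] ->
  head set0 (translate act g s) = act g @` head set0 s.
Proof. by case: s. Qed.

Lemma is_head_translate g s v : s != [::] ->
  is_head X s v -> is_head X (translate act g s) (act g v).
Proof.
move=> s0 [hv [w D]]; rewrite /is_head /seg_first head_translate //; split.
  by move=> /image_gact.
by exists (act g w); exact: dual_gact.
Qed.

Lemma translates_in_gact g s x y t : translates_in X act s x y t ->
  translates_in X act s (act g x) (act g y) (translate act g t).
Proof.
move=> [to txy]; split; first exact: seg_orbit_translate.
move=> _ /mapP[h /txy[hh hy hx] ->]; split; first exact: halfspace_gact.
  exact/image_gact.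
by move=> /image_gact.
Qed.

Lemma image_translates_in g s x y :
  translates_in X act s (act g x) (act g y) =
  translate act g @` translates_in X act s x y.
Proof.
apply/seteqP; split=> [t|_ [t txy <-]]; last exact: translates_in_gact.
move=> /(translates_in_gact g^-1); rewrite !gactK => txy.
exists (translate act g^-1%g t) => //; have := translateK g^-1%g t.
by rewrite invgK.
Qed.

Lemma segment_between s h : segment X s -> h \in s ->
  seg_last s `<=` h /\ h `<=` seg_first s.
Proof.
move=> [s0 _ st] hs; rewrite -(nth_index set0 hs).
rewrite /seg_first /seg_last -nth0 -nth_last.
have anti j i : (i <= j)%N -> (j < size s)%N -> nth set0 s j `<=` nth set0 s i.
  elim: j => [|j IH]; first by rewrite leqn0 => /eqP -> _; exact: subset_refl.
  rewrite leq_eqVlt => /predU1P[-> _|ij js]; first exact: subset_refl.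
  by apply: subset_trans (IH ij (ltnW js)); have [[]] := st _ js.
have := index_mem h s; rewrite hs => hlt; split; apply: anti => //.
  by rewrite -ltnS prednK.
by rewrite prednK.
Qed.

(** As the halfspaces of a segment are nested, avoiding [x] need only be checked on the largest one
    and containing [y] on the smallest. *)
Lemma translates_inE s x y t : segment X s ->
  translates_in X act s x y t <->
  [/\ seg_orbit act s t, ~ seg_first t x & seg_last t y].
Proof.
move=> segs; split=> [[to txy]|[to tx ty]].
  have [t0 _ _] := segment_orbit segs to; split=> //.
    have ft : seg_first t \in t by rewrite /seg_first -nth0 mem_nth.
    by have [] := txy _ ft.
  have lt : seg_last t \in t.
    by case: (t) t0 => // h t' _; rewrite /seg_last /=; exact: mem_last.
  by have [] := txy _ lt.
split=> // h ht; have segt := segment_orbit segs to.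
have [lh hf] := segment_between segt ht; split; [|exact: lh | by move=> /hf].
by case: segt => _ sh _; rewrite -(nth_index set0 ht); apply: sh; rewrite index_mem.
Qed.

End Automorphisms.

(** * Weighted median quasimorphisms *)

Lemma finite_seqs (T : choiceType) (A : set T) l : finite_set A ->
  finite_set [set t : seq T | size t = l /\ forall h, h \in t -> A h].
Proof.
move=> finA; elim: l => [|l IH].
  apply: (@sub_finite_set _ _ [set [::]]); last exact: finite_set1.
  by move=> t [/size0nil].
apply: (sub_finite_set _ (finite_image2 cons finA IH)) => -[[]//|h t] [[st] tA].
exists h; first by apply: tA; rewrite mem_head.
by exists t => //; split=> // k kt; apply: tA; rewrite inE kt orbT.
Qed.

Section WeightedCounts.
Variables (R : realType) (T : choiceType).
Implicit Types (phi : T -> R) (A U : set T).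

(** For infinite [A] the sum takes the default value 0, since [fset_set] is then empty. *)
Definition weighted_count phi A : R := \sum_(t <- fset_set A) phi t.

Lemma weighted_count_sub phi A U : finite_set U -> A `<=` U ->
  weighted_count phi A = \sum_(t <- fset_set U) phi t * `[< A t >]%:R.
Proof.
move=> finU AU; have finA := sub_finite_set AU finU.
rewrite /weighted_count (perm_big [seq t <- fset_set U | `[< A t >]]) /=.
  rewrite big_filter big_mkcond /=; apply: eq_bigr => t _.
  by case: ifP => _; rewrite ?mulr1 ?mulr0.
apply: uniq_perm; rewrite ?filter_uniq ?fset_uniq // => t.
rewrite mem_filter !in_fset_set //; apply/idP/andP.
  by move=> /set_mem tA; split; [exact/asboolP | exact/mem_set/AU].
by move=> [/asboolP tA _]; exact/mem_set.
Qed.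

Lemma eq_weighted_count phi psi A :
  finite_set A -> (forall t, A t -> phi t = psi t) ->
  weighted_count phi A = weighted_count psi A.
Proof.
move=> finA E; apply: eq_big_seq => t; rewrite in_fset_set // => /set_mem.
exact: E.
Qed.

Lemma weighted_count_image phi A (f : T -> T) : finite_set A -> injective f ->
  weighted_count phi (f @` A) = weighted_count (phi \o f) A.
Proof.
move=> finA inj_f; rewrite /weighted_count fset_set_image // big_imfset //=.
by move=> t t' _ _ /inj_f.
Qed.

Lemma norm_weighted_sum_le (L : seq T) phi (c : T -> R) (bad : pred T) M K :
  (forall t, `|phi t| <= M) -> (forall t, `|c t| <= K) ->
  (forall t, ~~ bad t -> c t = 0) ->
  `|\sum_(t <- L) phi t * c t| <= M * K * (count bad L)%:R.
Proof.
move=> phiM cK c0; elim: L => [|t L IH]; first by rewrite big_nil normr0 mulr0.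
rewrite big_cons /= natrD mulrDr (le_trans (ler_normD _ _)) // lerD //.
case: (boolP (bad t)) => [_|/c0 ->]; last by rewrite !mulr0 normr0.
by rewrite mulr1 normrM ler_pM.
Qed.

End WeightedCounts.

Section MedianQuasimorphism.
Variables (R : realType) (V : Type) (X : cube_complex V).
Variables (G : groupType) (act : group_action G V) (s : seq (set V)).
Hypotheses (catX : cat0 X) (dimX : finite_dimensional X)
  (stairX : finite_staircase_length X) (aut : by_automorphisms X act)
  (segs : segment X s).

Local Notation T := (translates_in X act s).

Lemma finite_translates_in x y : finite_set (T x y).
Proof.
apply: (sub_finite_set _ (finite_seqs (size s) (finite_interval catX x y))).
by move=> t [[g ->] txy]; rewrite /= size_map.
Qed.

Definition weighted_qm (phi : seq (set V) -> R) (x y : V) : R :=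
  weighted_count phi (T x y) - weighted_count phi (T y x).

Lemma weighted_qm1 : weighted_qm (fun=> 1) = median_qm R X act s.
Proof.
apply/funext => x; apply/funext => y; rewrite /median_qm /weighted_qm.
by rewrite !card_fset_sum1 !natr_sum.
Qed.

Lemma weighted_qmN phi x y : weighted_qm phi y x = - weighted_qm phi x y.
Proof. by rewrite /weighted_qm opprB. Qed.

Lemma weighted_qm_sum n (a : 'I_n -> R) (phi : 'I_n -> seq (set V) -> R) x y :
  weighted_qm (fun t => \sum_(i < n) a i * phi i t) x y =
  \sum_(i < n) a i * weighted_qm (phi i) x y.
Proof.
rewrite /weighted_qm /weighted_count; under [RHS]eq_bigr do rewrite mulrBr !mulr_sumr.
by rewrite sumrB; congr (_ - _); rewrite exchange_big.
Qed.

Lemma weighted_qmB phi psi a x y :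
  weighted_qm (fun t => phi t - a * psi t) x y =
  weighted_qm phi x y - a * weighted_qm psi x y.
Proof.
rewrite /weighted_qm /weighted_count !sumrB -!mulr_sumr mulrBr; lra.
Qed.

Lemma weighted_qm_gact phi g x y :
  weighted_qm phi (act g x) (act g y) = weighted_qm (phi \o translate act g) x y.
Proof.
have inj := can_inj (translateK act g).
by rewrite /weighted_qm !image_translates_in // !weighted_count_image //;
  exact: finite_translates_in.
Qed.

Lemma eq_weighted_qm phi psi x y : (forall t, seg_orbit act s t -> phi t = psi t) ->
  weighted_qm phi x y = weighted_qm psi x y.
Proof.
by move=> E; congr (_ - _); apply: eq_weighted_count => [|t [/E]//];
  exact: finite_translates_in.
Qed.

Definition cut (z : V) (t : seq (set V)) : bool :=
  `[< seg_first t z /\ ~ seg_last t z >].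

Lemma cut_translates_bound : exists C : nat, forall x y z (P : seq (seq (set V))),
  uniq P -> (forall t, t \in P -> T x y t /\ cut z t) -> (size P <= C)%N.
Proof.
have [C CP] := cut_chains_bound catX dimX stairX (size s).
exists C => x y z P uP PP; apply: (CP x y z P uP) => t tP.
have [[to txy] /asboolP[hz lz]] := PP t tP.
have [t0 _ tight_t] := segment_orbit catX aut segs to.
split=> //; first by case: to => g ->; rewrite size_map.
case: t t0 tight_t {tP to txy hz lz} => //= h t _.
elim: t h => //= k t IH h tight_t; split; first exact: (tight_t 0%N).
by apply: IH => i it; exact: (tight_t i.+1).
Qed.

(** The cyclic sum is rewritten as a sum over translates with coefficients [c t]. These vanish
    unless [t] lies between two of the points and is cut by the third, and [cut_translates_bound]
    limits the number of such [t]. *)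
Lemma weighted_qm_cocycle_bound : exists C : R, forall phi M,
  (forall t, `|phi t| <= M) -> forall x y z,
  `|weighted_qm phi x y + weighted_qm phi y z + weighted_qm phi z x| <= M * C.
Proof.
have [C CP] := cut_translates_bound.
(* One factor 6 bounds the coefficient [c t], the other counts the ordered pairs among [x], [y],
   [z]. *)
exists (6 * (6 * C)%:R) => phi M phiM x y z.
pose U := T x y `|` T y x `|` T y z `|` T z y `|` T z x `|` T x z.
have finU : finite_set U.
  by rewrite !finite_setU; do !split; exact: finite_translates_in.
pose b p q t := `[< T p q t >].
pose bad t := [|| b x y t && cut z t, b y x t && cut z t, b y z t && cut x t,
  b z y t && cut x t, b z x t && cut y t | b x z t && cut y t].
pose c t : R := (b x y t)%:R - (b y x t)%:R + ((b y z t)%:R - (b z y t)%:R)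
  + ((b z x t)%:R - (b x z t)%:R).
have -> : weighted_qm phi x y + weighted_qm phi y z + weighted_qm phi z x =
    \sum_(t <- fset_set U) phi t * c t.
  rewrite /weighted_qm !(weighted_count_sub _ finU); last 6 first.
  - by move=> t; rewrite /U /=; tauto.
  - by move=> t; rewrite /U /=; tauto.
  - by move=> t; rewrite /U /=; tauto.
  - by move=> t; rewrite /U /=; tauto.
  - by move=> t; rewrite /U /=; tauto.
  - by move=> t; rewrite /U /=; tauto.
  rewrite -!sumrB -!big_split /=; apply: eq_bigr => t _.
  by rewrite /c /b !mulrDr !mulrN.
have M0 : 0 <= M by apply: le_trans (phiM [::]); exact: normr_ge0.
have c6 t : `|c t| <= 6.
  have b01 p q : 0 <= (b p q t)%:R :> R /\ (b p q t)%:R <= 1 :> R.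
    by rewrite ler0n lern1 leq_b1; split.
  move: (b01 x y) (b01 y x) (b01 y z) (b01 z y) (b01 z x) (b01 x z).
  rewrite ler_norml /c => -[? ?] [? ?] [? ?] [? ?] [? ?] [? ?].
  by apply/andP; split; lra.
(* If the third point is not cut, it lies outside the first halfspace or inside the last, so [t] is
   crossed equally often in both directions around the cycle. The check is on the truth values [f]
   and [l], subject to [l] implying [f]. *)
have c0 t : ~~ bad t -> c t = 0.
  pose o := `[< seg_orbit act s t >].
  pose f p := `[< seg_first t p >]; pose l p := `[< seg_last t p >].
  have bE p q : b p q t = [&& o, ~~ f p & l q].
    apply/asboolP/and3P => [/(translates_inE catX aut _ _ _ segs)[? ? ?]|].
      by split; [exact/asboolP | exact/asboolPn | exact/asboolP].
    move=> [/asboolP ? /asboolPn ? /asboolP ?].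
    exact/(translates_inE catX aut _ _ _ segs).
  have cE p : cut p t = f p && ~~ l p.
    apply/asboolP/andP => -[? ?]; first by split; [exact/asboolP | exact/asboolPn].
    by split; [exact/asboolP | exact/asboolPn].
  have lf p : o -> l p ==> f p.
    move=> /asboolP to; apply/implyP => /asboolP lp; apply/asboolP.
    have segt := segment_orbit catX aut segs to.
    have [t0 _ _] := segt; have ht : head set0 t \in t by rewrite -nth0 mem_nth.
    by have [lh hf] := segment_between segt ht; exact/hf/lh.
  move=> nbad; suff : (b x y t + b y z t + b z x t = b y x t + b z y t + b x z t)%N.
    by move/(congr1 (fun m => m%:R : R)); rewrite /c !natrD; lra.
  move: nbad (lf x) (lf y) (lf z); rewrite /bad !bE !cE.
  case: (o) => //= + /(_ isT) + /(_ isT) + /(_ isT).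
  by case: (l x); case: (f x); case: (l y); case: (f y); case: (l z); case: (f z).
apply: le_trans (norm_weighted_sum_le _ phiM c6 c0) _.
rewrite -mulrA ler_wpM2l // ler_wpM2l // ler_nat -size_filter.
have cnt p q w : (count (fun t => b p q t && cut w t) (fset_set U) <= C)%N.
  rewrite -size_filter; apply: (CP p q w); first exact/filter_uniq/fset_uniq.
  by move=> t; rewrite mem_filter => /andP[/andP[/asboolP]].
have cntU (a a' : pred (seq (set V))) L :
    (count (fun t => a t || a' t) L <= count a L + count a' L)%N.
  by rewrite -[leqRHS]count_predUI leq_addr.
rewrite size_filter /bad.
do 5![apply: leq_trans (cntU _ _ _) _; rewrite mulSn leq_add ?cnt //].
by rewrite mul1n cnt.
Qed.

End MedianQuasimorphism.

(** * The cup product *)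

Section CupProduct.
Variables (R : realType) (V : Type) (X : cube_complex V).
Variables (G : groupType) (act : group_action G V) (s : seq (set V)).
Hypotheses (catX : cat0 X) (dimX : finite_dimensional X)
  (stairX : finite_staircase_length X) (aut : by_automorphisms X act)
  (segs : segment X s).

Local Notation f_s := (median_qm_cochain R X act s).
Local Notation wqm := (weighted_qm X act s).

Lemma median_qm_invariant : invariant_cochain act f_s.
Proof.
by move=> g x; rewrite /median_qm_cochain -!weighted_qm1 weighted_qm_gact.
Qed.

Lemma inord_lift n (x : 'I_n.+2 -> V) (j : 'I_n.+2) (i : 'I_n.+1) :
  x (lift j i) = x (inord (bump j i)).
Proof.
congr x; apply: val_inj; rewrite /= inordK //; exact: (valP (lift j i)).
Qed.

Lemma coboundary_median_qm x : coboundary f_s x =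
  wqm (fun=> 1) (x (inord 0)) (x (inord 1)) +
  wqm (fun=> 1) (x (inord 1)) (x (inord 2)) +
  wqm (fun=> 1) (x (inord 2)) (x (inord 0)).
Proof.
rewrite /coboundary !big_ord_recr big_ord0 /= /median_qm_cochain !inord_lift /=.
rewrite -!weighted_qm1 (weighted_qmN _ _ _ _ (x (inord 0)) (x (inord 2))).
rewrite /bump /=.
by rewrite expr0 expr1 expr2; ring.
Qed.

Lemma coboundary_median_qm_is_Zb : is_Zb act (coboundary f_s).
Proof.
split; last exact: coboundaryK.
split.
  have [C CP] := weighted_qm_cocycle_bound R catX dimX stairX aut segs.
  exists (1 * C) => x; rewrite coboundary_median_qm; apply: CP => t.
  by rewrite normr1.
move=> g x; rewrite /coboundary; apply: eq_bigr => j _; congr (_ * _).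
exact: (median_qm_invariant g (fun i => x (lift j i))).
Qed.

(** * A bounded invariant primitive of the cup product *)

Section Primitive.
Variables (n : nat) (k : cochain R V n).
Hypotheses (n_gt0 : (0 < n)%N) (kZ : is_Zb act k).
Hypothesis k_head : forall t, seg_orbit act s t -> forall (x : 'I_n -> V) v v',
  is_head X t v -> is_head X t v' -> k (cons_vertex v x) = k (cons_vertex v' x).
Variable head_of : seq (set V) -> V.
Hypothesis head_ofP : forall t, seg_orbit act s t -> is_head X t (head_of t).

(* In f_s(x_0, x_1) k(x_1, ...), every translate t counted by f_s contributes
   k(x_1, ...); here x_0 is instead replaced by a head of t. *)
Definition head_cochain : cochain R V n := fun x =>
  wqm (fun t => k (cons_vertex (head_of t) (fun i => x (lift ord0 i))))
      (x ord0) (x (inord 1)).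

Lemma cons_vertex_gact g v (x : 'I_n -> V) :
  cons_vertex (act g v) (fun i => act g (x i)) =
  (fun i => act g (cons_vertex v x i)).
Proof. by apply/funext => i; rewrite /cons_vertex; case: unlift. Qed.

(** The image under [g] of the chosen head of [t] is a head of the translated segment, though
    perhaps not the chosen one; [k_head] makes the two interchangeable. *)
Lemma head_cochain_invariant : invariant_cochain act head_cochain.
Proof.
move=> g x; rewrite /head_cochain weighted_qm_gact //.
apply: eq_weighted_qm => // t to.
have [_ kinv] := kZ.1; rewrite /= -[RHS](kinv g) -cons_vertex_gact.
have gto := seg_orbit_translate g to.
apply: (k_head gto); first exact: head_ofP.
apply: is_head_translate => //; last exact: head_ofP.
by have [] := segment_orbit catX aut segs to; case: (t).
Qed.

(** The unbounded term [f_s U k] cancels, leaving for fixed [x_2, ..., x_(n+1)] the cyclic sum of a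
    weighted quasimorphism, to which [weighted_qm_cocycle_bound] applies. *)
Lemma cup_coboundary_head_cochain (x : 'I_n.+2 -> V) :
  cup_at n.+1 f_s k x + coboundary head_cochain x =
  let phi t := k (cons_vertex (head_of t) (fun i => x (inord i.+2))) in
  wqm phi (x (inord 0)) (x (inord 1)) + wqm phi (x (inord 1)) (x (inord 2)) +
  wqm phi (x (inord 2)) (x (inord 0)).
Proof.
pose y i := x (inord i).
pose W (j : nat) t := k (cons_vertex (head_of t) (fun i => y (bump j i).+1)).
(* The cocycle identity at the head of [t] followed by [x_1, ..., x_(n+1)]; [W j t] is the face
   omitting [x_(j+1)]. *)
have kE t : k (fun i : 'I_n.+1 => y i.+1) = \sum_(j < n.+1) (-1) ^+ j * W j t.
  have := congr1 (fun c : cochain R V n.+1 =>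
    c (cons_vertex (head_of t) (fun i => y i.+1))) kZ.2.
  rewrite /coboundary big_ord_recl expr0 mul1r => /eqP; rewrite addr_eq0 => /eqP.
  rewrite (_ : (fun i => _) = (fun i : 'I_n.+1 => y i.+1)); last first.
    by apply/funext => i; rewrite /cons_vertex liftK.
  move=> ->; rewrite -sumrN; apply: eq_bigr => j _.
  rewrite lift0 exprS mulN1r mulNr opprK; congr (_ * k _).
  apply/funext => i; rewrite /cons_vertex; case: (unliftP ord0 i) => [i' ->|->].
    have -> : lift (lift ord0 j) (lift ord0 i') = lift ord0 (lift j i').
      by apply: val_inj; rewrite /= /bump !leq0n !add1n ltnS; case: leqP; lia.
    by rewrite liftK.
  have -> : lift (lift ord0 j) ord0 = ord0 by exact: val_inj.
  by rewrite unlift_none.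
(* Omitting [x_0] or [x_1] leaves the same arguments for the weight, whence the truncated
   predecessor [j.-1]; only the endpoints of the quasimorphism differ. *)
have HE (j : 'I_n.+2) : head_cochain (fun i => x (lift j i)) =
    wqm (W j.-1) (y (bump j 0)) (y (bump j 1)).
  rewrite /head_cochain !inord_lift /= inordK ?ltnS //; congr (wqm _ _ _).
  apply/funext => t; congr (k (cons_vertex _ _)); apply/funext => i.
  rewrite inord_lift /y; congr (x (inord _)); rewrite /= /bump.
  by case: (nat_of_ord j) => [|j']; rewrite /= ?leq0n; lia.
have tail : \sum_(j < n) (-1) ^+ j * wqm (W j.+1) (y 0) (y 1) =
    wqm (W 0) (y 0) (y 1) - k (fun i => y i.+1) * wqm (fun=> 1) (y 0) (y 1).
  rewrite -weighted_qm_sum -weighted_qmB; congr (weighted_qm _ _ _ _ _ _).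
  apply/funext => t; rewrite mulr1 (kE t) big_ord_recl expr0 mul1r opprD addNKr.
  by rewrite -sumrN; apply: eq_bigr => j _; rewrite exprS mulN1r mulNr opprK.
have cupE : cup_at n.+1 f_s k x =
    wqm (fun=> 1) (y 0) (y 1) * k (fun i : 'I_n.+1 => y i.+1).
  by rewrite weighted_qm1.
rewrite cupE /coboundary big_ord_recl big_ord_recl !HE /= expr0 expr1 mul1r.
rewrite (eq_bigr (fun j : 'I_n => (-1) ^+ j * wqm (W j.+1) (y 0) (y 1))); last first.
  by move=> j _; rewrite HE /= /bump /= !exprS !mulN1r opprK.
rewrite tail.
have -> : (fun t => k (cons_vertex (head_of t) (fun i => x (inord i.+2)))) = W 0.
  by [].
rewrite /bump /= -/(y 0) -/(y 1) -/(y 2) (weighted_qmN _ _ _ _ (y 0) (y 2)).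
ring.
Qed.

(** The coboundary of [f_s U k] is already the required cup product because [k] is a cocycle; adding
    a coboundary keeps this and makes the primitive bounded. *)
Lemma cup_median_qm_is_Bb : is_Bb act (cup (coboundary f_s) k).
Proof.
have [[k_bounded kinv] k0] := kZ; have [M kM] := k_bounded.
exists (cup_at n.+1 f_s k + coboundary head_cochain).
  split.
    have [C CP] := weighted_qm_cocycle_bound R catX dimX stairX aut segs.
    exists (M * C) => x.
    rewrite -[X in `|X|]/(cup_at n.+1 f_s k x + coboundary head_cochain x).
    by rewrite cup_coboundary_head_cochain; apply: CP => t; exact: kM.
  move=> g x; rewrite -[RHS]/(_ x + _ x).
  rewrite -[LHS]/(_ (fun i => act g (x i)) + _ (fun i => act g (x i))).
  congr (_ + _).
    rewrite /cup_at (median_qm_invariant g (fun i => x (inord i))).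
    by rewrite (kinv g (fun i => x (inord (1 + i)))).
  rewrite /coboundary; apply: eq_bigr => j _; congr (_ * _).
  exact: (head_cochain_invariant g (fun i => x (lift j i))).
suff : coboundary (cup_at n.+1 f_s k + coboundary head_cochain) =
    cup_at n.+2 (coboundary f_s) k by exact: esym.
rewrite coboundaryD coboundaryK addr0 coboundary_cup_at // k0.
apply/funext => x; rewrite -[LHS]/(_ x + _ * (_ * 0)).
by rewrite !mulr0 addr0.
Qed.

End Primitive.

Lemma exists_head t : segment X t -> exists v, is_head X t v.
Proof.
move=> [t0 th _]; have := th 0%N t0; rewrite nth0 => -[a [b [ab hE]]].
have ba := adj_sym ab; rewrite /is_head /seg_first.
case: hE => ->.
  exists b; split; first exact: closer_r.
  by exists a; split=> //; right.
exists a; split; first exact: closer_r.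
by exists b; split=> //; right.
Qed.

Lemma exists_head_of : exists head_of : seq (set V) -> V,
  forall t, seg_orbit act s t -> is_head X t (head_of t).
Proof.
have [[v0 _] _ _] := catX.1.
suff /choice[p pP] : forall t, exists v, seg_orbit act s t -> is_head X t v.
  by exists p.
(* The arbitrary vertex [v0] serves as a default outside the orbit. *)
move=> t; have [to|nto] := pselect (seg_orbit act s t); last by exists v0.
by have [v vP] := exists_head (segment_orbit catX aut segs to); exists v.
Qed.

End CupProduct.

(** * Non-transversality for a second median quasimorphism *)

Section SecondSegment.
Variables (R : realType) (V : Type) (X : cube_complex V).
Variables (G : groupType) (act : group_action G V) (s r : seq (set V)).
Hypotheses (catX : cat0 X) (aut : by_automorphisms X act)
  (segs : segment X s) (segr : segment X r).

Lemma head_edge t v w : is_head X t v -> dual X v w (seg_first t) ->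
  adj X v w /\ seg_first t = closer X w v.
Proof.
by move=> [hv _] [vw [E|//]]; case: hv; rewrite E; exact: closer_l.
Qed.

(* The edges at v and v' dual to the first halfspace of t do not cross u, so u
   separates their far endpoints as well. *)
Lemma heads_separated_transverse t v v' u : is_head X t v -> is_head X t v' ->
  halfspace X u -> ~ u v -> u v' -> transverse (seg_first t) u.
Proof.
move=> hv hv' hu uv uv'.
have [nv [w /(head_edge hv)[vw hE]]] := hv.
have [nv' [w' /(head_edge hv')[vw' hE']]] := hv'.
have uw : ~ u w.
  move=> uw; have := halfspace_closer catX hu (adj_sym vw) uw uv; rewrite -hE => uE.
  by apply: nv'; rewrite -uE.
have uw' : u w'.
  apply: contrapT => nuw'.
  have := halfspace_closer catX hu vw' uv' nuw'.
  rewrite -(closer_setC catX (adj_sym vw')) -hE' => uE.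
  by apply: uv; rewrite uE.
have tw : seg_first t w by rewrite hE; exact/closer_l/adj_sym.
have tw' : seg_first t w' by rewrite hE'; exact/closer_l/adj_sym.
by split; [exists w' | exists v' | exists w | exists v].
Qed.

Hypotheses (n1 : nontransverse_orbits act (seg_first s) (seg_first r))
  (n2 : nontransverse_orbits act (seg_first s) (seg_last r)).

Lemma seg_first_translate g q : segment X q ->
  seg_first (translate act g q) = act g @` seg_first q.
Proof. by case: q => [[]|]. Qed.

Lemma seg_last_translate g q : segment X q ->
  seg_last (translate act g q) = act g @` seg_last q.
Proof. by case: q => [[]|h q _] //; exact: (last_map (fun h => act g @` h)). Qed.

(** Moving between heads of [t] does not change which translates of [r] lie in an interval to or
    from another vertex. A change would need a first or last halfspace of such a translate to
    separate the heads, hence to be transverse to [seg_first t], against [n1] or [n2]. *)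
Lemma coboundary_median_qm_heads t (x : 'I_2 -> V) v v' : seg_orbit act s t ->
  is_head X t v -> is_head X t v' ->
  coboundary (median_qm_cochain R X act r) (cons_vertex v x) =
  coboundary (median_qm_cochain R X act r) (cons_vertex v' x).
Proof.
move=> to hv hv'.
have sub a p q : is_head X t p -> is_head X t q ->
    translates_in X act r p a `<=` translates_in X act r q a.
  move=> hp hq u /(translates_inE catX aut _ _ _ segr)[uo up ua].
  apply/(translates_inE catX aut _ _ _ segr); split=> // uq.
  have segu := segment_orbit catX aut segr uo.
  have hu : halfspace X (seg_first u).
    by case: segu => u0 hu _; rewrite /seg_first -nth0; exact: hu.
  have := heads_separated_transverse hp hq hu up uq.
  case: to uo => g -> [g' ->]; rewrite !seg_first_translate // => tr.
  by apply: n1; exists g, g'.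
have sub' a p q : is_head X t p -> is_head X t q ->
    translates_in X act r a p `<=` translates_in X act r a q.
  move=> hp hq u /(translates_inE catX aut _ _ _ segr)[uo ua up].
  apply/(translates_inE catX aut _ _ _ segr); split=> //; apply: contrapT => uq.
  have segu := segment_orbit catX aut segr uo.
  have hu : halfspace X (seg_last u).
    by case: segu => u0 hu _; rewrite /seg_last -nth_last; apply: hu; rewrite prednK.
  have := heads_separated_transverse hq hp hu uq up.
  case: to uo => g -> [g' ->].
  rewrite seg_first_translate // seg_last_translate // => tr.
  by apply: n2; exists g, g'.
have E a : translates_in X act r v a = translates_in X act r v' a.
  by apply/seteqP; split; apply: sub.
have E' a : translates_in X act r a v = translates_in X act r a v'.
  by apply/seteqP; split; apply: sub'.
have cE p : cons_vertex p x (inord 0) = p.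
  rewrite /cons_vertex (_ : inord 0 = ord0) ?unlift_none //.
  by apply: val_inj; rewrite /= inordK.
have cE1 (i : 'I_2) p : cons_vertex p x (inord i.+1) = x i.
  rewrite /cons_vertex (_ : inord i.+1 = lift ord0 i) ?liftK //.
  by apply: val_inj; rewrite /= inordK // ltnS; exact: ltn_ord.
rewrite !coboundary_median_qm !cE !(cE1 ord0) !(cE1 ord_max).
by rewrite /weighted_qm !E !E'.
Qed.

End SecondSegment.

Theorem theorem1p6 (R : realType) (V : Type) (X : cube_complex V)
    (Gamma : groupType) (act : group_action Gamma V) (s : seq (set V)) :
  by_automorphisms X act ->
  cat0 X ->
  finite_dimensional X ->
  finite_staircase_length X ->
  segment X s ->
  exists2 fs : Zb R act 2,
    (fs : cochain R V 2) = coboundary (median_qm_cochain R X act s) &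
    (forall (n : nat) (zeta : Hb R act n),
       (1 <= n)%N ->
       nontransverse_class X zeta (seg_orbit act s) ->
       Hb_cup (Hb_class fs) zeta = 0) /\
    (forall r : seq (set V),
       segment X r ->
       nontransverse_orbits act (seg_first s) (seg_first r) ->
       nontransverse_orbits act (seg_first s) (seg_last r) ->
       nontransverse_orbits act (seg_last s) (seg_first r) ->
       nontransverse_orbits act (seg_last s) (seg_last r) ->
       exists2 fr : Zb R act 2,
         (fr : cochain R V 2) = coboundary (median_qm_cochain R X act r) &
         Hb_cup (Hb_class fs) (Hb_class fr) = 0).
Proof.
move=> aut catX dimX stairX segs.
have fZ q : segment X q ->
    coboundary (median_qm_cochain R X act q) \in @Zb_pred R V Gamma act 2.
  by move=> segq; apply/asboolP; exact: coboundary_median_qm_is_Zb.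
have [head_of head_ofP] := exists_head_of catX aut segs.
(* Both conclusions are obtained from this passage from the cochain-level primitive to the vanishing
   of the class. *)
have cup0 n (k : Zb R act n) : (0 < n)%N ->
    (forall t, seg_orbit act s t -> forall (x : 'I_n -> V) v v',
      is_head X t v -> is_head X t v' ->
      zval k (cons_vertex v x) = zval k (cons_vertex v' x)) ->
    Hb_cup (Hb_class (MkZb (fZ s segs))) (Hb_class k) = 0.
  move=> n0 k_head; rewrite Hb_cupE.
  rewrite (_ : 0 = Hb_class 0); last first.
    by rewrite /Hb_class; apply/esym; exact: pi_zeror.
  apply/Hb_classP; rewrite -[zval 0]/(0) subr0.
  apply: (cup_median_qm_is_Bb catX dimX stairX aut segs n0 _ k_head head_ofP).
  by have /asboolP := zvalP k.
exists (MkZb (fZ s segs)) => //; split.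
  move=> n zeta n0 [k <- k_nt]; apply: cup0 => // t to x v v' hv hv'.
  by have [+ _] := k_nt t to x; apply.
move=> r segr n1 n2 _ _; exists (MkZb (fZ r segr)) => //.
apply: cup0 => // t to x v v' hv hv'.
by apply: coboundary_median_qm_heads to hv hv'.
Qed.
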